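(* Let $p$, $L$, $\mathbf L$, $W_{\mathrm G}$, $\mathrm G$, $\mathbf W_{\mathrm D}$, $\mathrm D$, $V$ be as in the context, let $f\in L'$ and $\mathbf F\in\mathbf L'$, and let $\mathbf a:L\times\mathbf L\to\mathbf L'$ and $a:L\to V$ satisfy assumptions (A1)–(A6) of the context. Let $(\mathcal D_m)_{m\in\mathbb N}$ be a sequence of gradient discretisations that is consistent and limit-conforming. Then, for any $m\in\mathbb N$, there exists at least one $u_m\in X_{\mathcal D_m}$ solution to the gradient scheme $$\forall v\in X_{\mathcal D_m},\quad \langle\mathbf a(P_{\mathcal D_m}u_m,G_{\mathcal D_m}u_m),G_{\mathcal D_m}v\rangle_{\mathbf L',\mathbf L}+\langle a(P_{\mathcal D_m}u_m),P_{\mathcal D_m}v\rangle_{L',L}=\langle f,P_{\mathcal D_m}v\rangle_{L',L}-\langle\mathbf F,G_{\mathcal D_m}v\rangle_{\mathbf L',\mathbf L}.\qquad(\mathrm{GS})$$ Moreover, given for each $m$ a solution $u_m$ of $(\mathrm{GS})$, and considering the problem: find $\bar u\in W_{\mathrm G}$ such that $$\forall v\in W_{\mathrm G},\quad \langle\mathbf a(\bar u,\mathrm G\bar u),\mathrm Gv\rangle_{\mathbf L',\mathbf L}+\langle a(\bar u),v\rangle_{L',L}=\langle f,v\rangle_{L',L}-\langle\mathbf F,\mathrm Gv\rangle_{\mathbf L',\mathbf L},\qquad(\mathrm P)$$ the following hold. (i) If $\mathbf a$ only depends on its second argument, then there exists a solution $\bar u$ of $(\mathrm P)$ such that, up to a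 subsequence, $P_{\mathcal D_m}u_m$ converges weakly in $L$ to $\bar u$ and $G_{\mathcal D_m}u_m$ converges weakly in $\mathbf L$ to $\mathrm G\bar u$ as $m\to\infty$. (ii) In the case where $\mathbf a$ may also depend on its first argument, if moreover the sequence $(\mathcal D_m)_{m\in\mathbb N}$ is compact, then there exists a solution $\bar u$ of $(\mathrm P)$ such that, up to a subsequence, $P_{\mathcal D_m}u_m$ converges strongly in $L$ to $\bar u$ and $G_{\mathcal D_m}u_m$ converges weakly in $\mathbf L$ to $\mathrm G\bar u$ as $m\to\infty$. In the case where the solution $\bar u$ of $(\mathrm P)$ is unique, the convergences hold for the whole sequence, without extraction of a subsequence: if $\mathbf a$ only depends on its second argument, then the whole sequence $(P_{\mathcal D_m}u_m)_{m\in\mathbb N}$ converges weakly in $L$ to $\bar u$ and the whole sequence $(G_{\mathcal D_m}u_m)_{m\in\mathbb N}$ converges weakly in $\mathbf L$ to $\mathrm G\bar u$; and if $\mathbf a$ may also depend on its first argument and the sequence $(\mathcal D_m)_{m\in\mathbb N}$ is compact, then the whole sequence $(P_{\mathcal D_m}u_m)_{m\in\mathbb N}$ converges strongly in $L$ to $\bar u$ and the whole sequence $(G_{\mathcal D_m}u_m)_{m\in\mathbb N}$ converges weakly in $\mathbf L$ to $\mathrm G\bar u$.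
   Context: All vector spaces are real. Let $p\in(1,+\infty)$ and $p'$ with $1/p+1/p'=1$. Let $L$ and $\mathbf L$ be separable reflexive Banach spaces with topological duals $L'$ and $\mathbf L'$. Let $W_{\mathrm G}\subset L$ be a dense linear subspace of $L$ and let $\mathrm G:W_{\mathrm G}\to\mathbf L$ be a linear operator whose graph is closed in $L\times\mathbf L$. Put $\|u\|_{W_{\mathrm G},\mathcal G}=(\|u\|_L^p+\|\mathrm Gu\|_{\mathbf L}^p)^{1/p}$ for $u\in W_{\mathrm G}$. Define $\mathbf W_{\mathrm D}=\{\mathbf v\in\mathbf L' : \exists w\in L',\ \forall u\in W_{\mathrm G},\ \langle\mathbf v,\mathrm Gu\rangle_{\mathbf L',\mathbf L}+\langle w,u\rangle_{L',L}=0\}$; for $\mathbf v\in\mathbf W_{\mathrm D}$ the element $w$ is unique and one sets $\mathrm D\mathbf v:=w$. Let $V$ be a closed subspace of $L'$. For $u\in L$ put $|u|_{L,V}=\sup_{\mu\in V\setminus\{0\}}\frac{|\langle\mu,u\rangle_{L',L}|}{\|\mu\|_{L'}}$ if $V\neq\{0\}$ and $|u|_{L,V}=0$ if $V=\{0\}$. For $u\in W_{\mathrm G}$ put $\|u\|_{W_{\mathrm G}}=(|u|_{L,V}^p+\|\mathrm Gu\|_{\mathbf L}^p)^{1/p}$. Standing assumption: there is $C_{W_{\mathrm G},V}>0$ with $\|u\|_{W_{\mathrm G},\mathcal G}\le C_{W_{\mathrm G},V}\|u\|_{W_{\mathrm G}}$ for all $u\in W_{\mathrm G}$. Assumptions on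 $\mathbf a:L\times\mathbf L\to\mathbf L'$ and $a:L\to V\subset L'$, with constants $\overline\alpha\ge0$, $\underline\alpha>0$: (A1) for each $\mathbf v\in\mathbf L$, $\mathbf a(\cdot,\mathbf v)$ is continuous from $L$ to $\mathbf L'$ with its strong (norm) topology; for each $v\in L$, $\mathbf a(v,\cdot)$ is continuous from $\mathbf L$ (norm topology) to $\mathbf L'$ with its weak-$\star$ topology; and $\|\mathbf a(v,\mathbf v)\|_{\mathbf L'}\le\overline\alpha(1+\|v\|_L^{p-1}+\|\mathbf v\|_{\mathbf L}^{p-1})$ for all $v\in L$, $\mathbf v\in\mathbf L$. (A2) $\langle\mathbf a(v,\mathbf v)-\mathbf a(v,\mathbf w),\mathbf v-\mathbf w\rangle_{\mathbf L',\mathbf L}\ge0$ for all $v\in L$, $\mathbf v,\mathbf w\in\mathbf L$. (A3) $\underline\alpha\|\mathbf v\|_{\mathbf L}^p\le\langle\mathbf a(v,\mathbf v),\mathbf v\rangle_{\mathbf L',\mathbf L}$ for all $v\in L$, $\mathbf v\in\mathbf L$. (A4) $a$ is continuous from $L$ (norm topology) to $L'$ with its weak-$\star$ topology, and $\|a(v)\|_{L'}\le\overline\alpha(1+\|v\|_L^{p-1})$ for all $v\in L$. (A5) $\langle a(v)-a(w),v-w\rangle_{L',L}\ge0$ for all $v,w\in L$. (A6) $\underline\alpha|v|_{L,V}^p\le\langle a(v),v\rangle_{L',L}$ for all $v\in L$. A gradient discretisation is a triple $\mathcal D=(X_{\mathcal D},P_{\mathcal D},G_{\mathcal D})$ where $X_{\mathcal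 D}$ is a finite dimensional real vector space, $P_{\mathcal D}:X_{\mathcal D}\to L$ and $G_{\mathcal D}:X_{\mathcal D}\to\mathbf L$ are linear, and $\|v\|_{\mathcal D}:=(|P_{\mathcal D}v|_{L,V}^p+\|G_{\mathcal D}v\|_{\mathbf L}^p)^{1/p}$ is a norm on $X_{\mathcal D}$. A sequence $(\mathcal D_m)_{m\in\mathbb N}$ of gradient discretisations is: - consistent if $\lim_{m\to\infty}S_{\mathcal D_m}(\varphi)=0$ for all $\varphi\in W_{\mathrm G}$, where $S_{\mathcal D}(\varphi)=\min_{v\in X_{\mathcal D}}(\|P_{\mathcal D}v-\varphi\|_L+\|G_{\mathcal D}v-\mathrm G\varphi\|_{\mathbf L})$; - limit-conforming if $\lim_{m\to\infty}W_{\mathcal D_m}(\boldsymbol\varphi)=0$ for all $\boldsymbol\varphi\in\mathbf W_{\mathrm D}$, where $W_{\mathcal D}(\boldsymbol\varphi)=\sup_{u\in X_{\mathcal D}\setminus\{0\}}\frac{|\langle\boldsymbol\varphi,G_{\mathcal D}u\rangle_{\mathbf L',\mathbf L}+\langle\mathrm D\boldsymbol\varphi,P_{\mathcal D}u\rangle_{L',L}|}{\|u\|_{\mathcal D}}$; - compact if, for any sequence $u_m\in X_{\mathcal D_m}$ such that $(\|u_m\|_{\mathcal D_m})_{m\in\mathbb N}$ is bounded, the sequence $(P_{\mathcal D_m}u_m)_{m\in\mathbb N}$ is relatively compact in $L$. *)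

(* Defs.v *)
From HB Require Import structures.
From mathcomp Require Import all_boot all_order all_algebra.
From mathcomp Require Import all_classical all_reals all_analysis.

Set Implicit Arguments.
Unset Strict Implicit.
Unset Printing Implicit Defensive.

Import Order.TTheory GRing.Theory Num.Theory.
Import numFieldNormedType.Exports.

Local Open Scope classical_set_scope.
Local Open Scope ring_scope.

Section Dual.
Variables (R : realType) (E : normedModType R).

Definition is_dual : {pred E -> R^o} :=
  fun f => `[< linear f /\ continuous f >].

Lemma is_dual_submod_closed : submod_closed is_dual.
Proof.
split=> [|k f g /asboolP[lf cf] /asboolP[lg cg]]; apply/asboolP; split.
- by move=> a x y /=; rewrite scaler0 addr0.
- exact: cst_continuous.
- move=> a x y; rewrite /= !fctE lf lg !scalerDr !scalerA (mulrC k a).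
  by rewrite addrACA.
- move=> x; apply: (@continuousD _ _ _ (k *: f) g); last exact: cg.
  exact: continuousZr (cf x).
Qed.

HB.instance Definition _ :=
  GRing.isSubmodClosed.Build R (E -> R^o) is_dual is_dual_submod_closed.

Record dual := Dual { dual_fun :> E -> R^o ; _ : dual_fun \in is_dual }.

HB.instance Definition _ := [isSub for dual_fun].
HB.instance Definition _ := [Choice of dual by <:].
HB.instance Definition _ := [SubChoice_isSubLmodule of dual by <:].

Lemma dual_linear (f : dual) : linear f.
Proof. by have /asboolP[] := valP f. Qed.

Lemma dual_continuous (f : dual) : continuous f.
Proof. by have /asboolP[] := valP f. Qed.

HB.instance Definition _ (f : dual) :=
  GRing.isLinear.Build R E R^o _ (dual_fun f) (dual_linear f).

(* The supremum is a real number because of dual_norm_has_sup. *)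
Definition dual_norm (f : dual) : R :=
  sup [set `|f x| | x in [set x : E | `|x| <= 1]].

Lemma dual_norm_has_sup (f : dual) :
  has_sup [set `|f x| | x in [set x : E | `|x| <= 1]].
Proof.
split; first by exists `|f 0|, 0 => //=; rewrite normr0.
have /linear_bounded_continuous/bounded_funP/(_ 1)[M fM] :=
  @dual_continuous f.
by exists M => _ [x x1 <-]; exact: fM.
Qed.

Lemma dual_norm_ge0 (f : dual) : 0 <= dual_norm f.
Proof.
apply: le_trans (normr_ge0 (f 0)) _.
by apply: (sup_upper_bound (dual_norm_has_sup f)); exists 0 => //=; rewrite normr0.
Qed.

Lemma le_dual_norm (f : dual) (x : E) : `|f x| <= dual_norm f * `|x|.
Proof.
have [->|x0] := eqVneq x 0; first by rewrite linear0 !normr0 mulr0.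
have nx : 0 < `|x| by rewrite normr_gt0.
rewrite -ler_pdivrMr//; apply: (sup_upper_bound (dual_norm_has_sup f)).
exists (`|x|^-1 *: x) => /=.
  by rewrite normrZ normfV normr_id mulVf// gt_eqF.
by rewrite linearZ normrZ normfV normr_id mulrC.
Qed.

Let dual_normD (f g : dual) : dual_norm (f + g) <= dual_norm f + dual_norm g.
Proof.
apply: ge_sup; first by have [] := dual_norm_has_sup (f + g).
move=> _ [x /= x1 <-]; apply: le_trans (ler_normD _ _) _.
by apply: lerD; apply: le_trans (le_dual_norm _ _) _;
  rewrite -[leRHS]mulr1 ler_wpM2l// dual_norm_ge0.
Qed.

Let dual_norm_leZ (k : R) (f : dual) : dual_norm (k *: f) <= `|k| * dual_norm f.
Proof.
apply: ge_sup; first by have [] := dual_norm_has_sup (k *: f).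
move=> _ [x /= x1 <-]; rewrite normrZ ler_wpM2l//.
by apply: (sup_upper_bound (dual_norm_has_sup f)); exists x.
Qed.

Let dual_normZ (k : R) (f : dual) : dual_norm (k *: f) = `|k| * dual_norm f.
Proof.
apply/eqP; rewrite eq_le dual_norm_leZ /=.
have [->|k0] := eqVneq k 0; first by rewrite normr0 mul0r dual_norm_ge0.
rewrite mulrC -ler_pdivlMr ?normr_gt0// -normfV mulrC.
by rewrite -[X in dual_norm X <= _](scalerK k0) dual_norm_leZ.
Qed.

Let dual_norm_eq0 (f : dual) : dual_norm f = 0 -> f = 0.
Proof.
move=> f0; apply/val_inj/funext => x /=; apply/eqP; rewrite -normr_le0.
by have := le_dual_norm f x; rewrite f0 mul0r.
Qed.

HB.instance Definition _ :=
  Lmodule_isNormed.Build R dual dual_normD dual_normZ dual_norm_eq0.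

End Dual.
Section Weak.
Variables (R : realType) (E : normedModType R).

(* The dual with its weak-star topology, the coarsest one for which all the
   evaluations at points of E are continuous. *)
Definition weak_star : Type :=
  initial_topology (fun mu : dual E => (mu : E -> R^o) : {ptws E -> R^o}).

(* E with its weak topology, the coarsest one for which all the elements of the
   dual are continuous. *)
Definition weak : Type :=
  initial_topology (fun x : E => (fun mu : dual E => mu x) : {ptws dual E -> R^o}).

HB.instance Definition _ := Topological.on weak_star.
HB.instance Definition _ := Topological.on weak.

Definition weakly_cvg (u : nat -> E) (x : E) : Prop :=
  (u : nat -> weak) @ \oo --> (x : weak).

(* The canonical embedding of E into its bidual is onto. *)
Definition reflexive_space : Prop :=
  forall Phi : dual (dual E), exists x : E, forall mu : dual E, Phi mu = mu x.

End Weak.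

Definition separable_space (T : topologicalType) : Prop :=
  exists2 A : set T, countable A & dense A.

Definition depends_only_on_snd (A B C : Type) (f : A -> B -> C) : Prop :=
  forall x y z, f x z = f y z.

Section SubmodOf.
Variables (R : pzRingType) (E : lmodType R) (W : submodClosed E).

Definition submod_of : Type := {x : E | x \in W}.

HB.instance Definition _ := SubChoice.on submod_of.
HB.instance Definition _ := [SubChoice_isSubLmodule of submod_of by <:].

End SubmodOf.

(* A leading b marks the boldface objects of the paper: bL and L are distinct
   spaces, as are ba and a below. *)
Section AbstractSpaces.
Variables (R : realType) (p : R) (L bL : normedModType R).
Variables (WG : submodClosed L) (G : {linear submod_of WG -> bL}).
Variable (V : submodClosed (dual L)).

Definition closed_graph : Prop :=
  closed [set z : L * bL | exists u : submod_of WG, z = (val u, G u)].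

Definition normWG_graph (u : submod_of WG) : R :=
  (`|val u| `^ p + `|G u| `^ p) `^ p^-1.

(* For V = {0} the set is empty and its supremum is 0; otherwise the set is
   bounded above by `|u|. *)
Definition seminormV (u : L) : R :=
  sup [set `|mu u| / `|mu| | mu in [set mu : dual L | mu \in V /\ mu != 0]].

Definition normWG (u : submod_of WG) : R :=
  (seminormV (val u) `^ p + `|G u| `^ p) `^ p^-1.

Definition is_D_of (v : dual bL) (w : dual L) : Prop :=
  forall u : submod_of WG, v (G u) + w (val u) = 0.

Definition WD : set (dual bL) := [set v | exists w, is_D_of v w].

(* Density of WG makes w unique; the default value 0 outside WD plays no role. *)
Definition Dop (v : dual bL) : dual L := xget 0 [set w | is_D_of v w].

Definition is_norm (X : lmodType R) (N : X -> R) : Prop :=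
  [/\ forall x, 0 <= N x,
      forall x y, N (x + y) <= N x + N y,
      forall k x, N (k *: x) = `|k| * N x &
      forall x, N x = 0 -> x = 0].

Record grad_disc := GradDisc {
  gd_space : vectType R ;
  gd_P : {linear gd_space -> L} ;
  gd_G : {linear gd_space -> bL} ;
  gd_is_norm : is_norm
        (fun v => (seminormV (gd_P v) `^ p + `|gd_G v| `^ p) `^ p^-1)
}.

Definition gd_norm (D : grad_disc) (v : gd_space D) : R :=
  (seminormV (gd_P D v) `^ p + `|gd_G D v| `^ p) `^ p^-1.

(* The infimum is attained, gd_space D being finite dimensional. *)
Definition S_D (D : grad_disc) (phi : submod_of WG) : R :=
  inf [set `|gd_P D v - val phi| + `|gd_G D v - G phi| | v in [set: gd_space D]].

(* The set is bounded above, gd_space D being finite dimensional; the supremum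
   is 0 when gd_space D is reduced to 0. *)
Definition W_D (D : grad_disc) (phi : dual bL) : R :=
  sup [set `|phi (gd_G D u) + Dop phi (gd_P D u)| / gd_norm u
      | u in [set u : gd_space D | u != 0]].

Definition consistent (D : nat -> grad_disc) : Prop :=
  forall phi : submod_of WG, (fun m => S_D (D m) phi) @ \oo --> (0 : R).

Definition limit_conforming (D : nat -> grad_disc) : Prop :=
  forall phi : dual bL, WD phi -> (fun m => W_D (D m) phi) @ \oo --> (0 : R).

Definition compact_gds (D : nat -> grad_disc) : Prop :=
  forall u : (forall m, gd_space (D m)),
    (exists M : R, forall m, gd_norm (u m) <= M) ->
    precompact (range (fun m => gd_P (D m) (u m))).

Section Problem.
Variables (ba : L -> bL -> dual bL) (a : L -> dual L).
Variables (f : dual L) (bF : dual bL).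

Definition GS_solution (D : grad_disc) (u : gd_space D) : Prop :=
  forall v : gd_space D,
    ba (gd_P D u) (gd_G D u) (gd_G D v) + a (gd_P D u) (gd_P D v)
    = f (gd_P D v) - bF (gd_G D v).

Definition P_solution (u : submod_of WG) : Prop :=
  forall v : submod_of WG,
    ba (val u) (G u) (G v) + a (val u) (val v) = f (val v) - bF (G v).

Section Assumptions.
(* alphaU and alphaL are the overlined and underlined constants alpha. *)
Variables (alphaU alphaL : R).

Definition assumption_A1 : Prop :=
  [/\ forall vv : bL, continuous (fun v : L => ba v vv),
      forall v : L, continuous (fun vv : bL => (ba v vv : weak_star bL)) &
      forall (v : L) (vv : bL),
        `|ba v vv| <= alphaU * (1 + `|v| `^ (p - 1) + `|vv| `^ (p - 1))].

Definition assumption_A2 : Prop :=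
  forall (v : L) (vv ww : bL), 0 <= (ba v vv - ba v ww) (vv - ww).

Definition assumption_A3 : Prop :=
  forall (v : L) (vv : bL), alphaL * `|vv| `^ p <= ba v vv vv.

Definition assumption_A4 : Prop :=
  continuous (fun v : L => (a v : weak_star L)) /\
  forall v : L, `|a v| <= alphaU * (1 + `|v| `^ (p - 1)).

Definition assumption_A5 : Prop :=
  forall v w : L, 0 <= (a v - a w) (v - w).

Definition assumption_A6 : Prop :=
  forall v : L, alphaL * seminormV v `^ p <= a v v.

End Assumptions.
End Problem.
End AbstractSpaces.

(* Main.v *)
Require Import Defs.
From HB Require Import structures.
From mathcomp Require Import all_boot all_order all_algebra.
From mathcomp Require Import all_classical all_reals all_analysis.
From mathcomp Require Import ring lra.

Set Implicit Arguments.
Unset Strict Implicit.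
Unset Printing Implicit Defensive.

Import Order.TTheory GRing.Theory Num.Theory.
Import numFieldNormedType.Exports.

Local Open Scope classical_set_scope.
Local Open Scope ring_scope.

(** The proof follows the classical compactness method; three ingredients
    carry it.

    Uniform estimates. Along a limit-conforming sequence of discretisations the
    operators P are bounded by the discrete norms uniformly in m
    ([limit_conforming_coercive]). By the assumed equivalence of norms on WG,
    Hahn-Banach writes every functional on L, restricted to WG, as the sum of
    one that is controlled by the V-seminorm and of one that acts on the
    gradient; the latter is an element of WD, whose conformity defect is
    bounded in m. So the normalised reconstructions are weakly bounded, and
    Banach-Steinhaus makes them bounded. Testing the scheme with its own
    solution then bounds the discrete norms of the solutions.

    Existence for the scheme. On a finite dimensional space the scheme asks for
    a zero of a continuous field that points outwards far away. The field is
    not monotone, because the operator depends on its first argument; the zero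
    comes from a form of Brouwer's theorem ([zero_of_outward_field]), derived
    from the Poincare-Miranda theorem ([poincare_miranda]), itself obtained from a
    combinatorial degree modulo 2 on a grid ([grid_degree]). Joint continuity of
    the field, of which only separate continuity is assumed, comes from
    monotonicity ([demicontinuous]).

    Passage to the limit. All limits are taken along an ultrafilter U on nat that
    refines the filter of neighbourhoods of infinity: bounded real quantities
    then converge with no extraction, and reflexivity alone yields weak limits
    y of P u and z of G u. Limit-conformity shows that (y, z) is annihilated by
    everything that annihilates the graph of G, so (y, z) lies in this closed
    graph ([closed_graph_annihilator]). Consistency gives the limit equation
    chi (G v) + chi0 v = f v - bF (G v), with chi and chi0 the weak-star limits
    of the two nonlinear terms; they are identified by Minty's trick
    ([minty_eq]). Each nonlinear term satisfies a lower bound in the limit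
    ([minty_liminf]), while the energy identity fixes the sum of the two, so
    both bounds are equalities. The first argument of ba enters through the
    fact that ba (P u) w tends to ba y w in norm: this is immediate if ba
    does not depend on it, and follows from the strong convergence of P u in the
    compact case.

    The two forms of the conclusion both come from the limits along ultrafilters.
    Separability provides countably many functionals that determine weak limits
    of bounded sequences, whence a subsequence. If the solution is unique, the
    limits along all these ultrafilters coincide, which is convergence of the
    whole sequence ([cvg_ultraP]). *)

(** * A combinatorial degree modulo 2 on a cubical grid *)

Section GridDegree.
Variables (n N : nat).
Hypothesis N_gt0 : (0 < N)%N.
Local Notation point := {ffun 'I_n -> 'I_N.+1}.
Variable y : 'I_n -> point -> bool.

(** The step is cyclic, which makes it a bijection of the whole grid: sums can
    then be reindexed by it. Steps that wrap around never contribute below. *)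
Definition gstep (z : point) (i : 'I_n) : point :=
  [ffun j => if j == i then ordS (z j) else z j].

Lemma gstepC z i j : gstep (gstep z i) j = gstep (gstep z j) i.
Proof.
by apply/ffunP => k; rewrite !ffunE; case: (k == i); case: (k == j).
Qed.

Lemma gstep_inj i : injective (gstep ^~ i).
Proof.
move=> z w /ffunP zw; apply/ffunP => k; have := zw k; rewrite !ffunE.
by case: eqP => // _ /ordS_inj.
Qed.

(** With the labels [y c] seen as cochains modulo 2 and s as long as S, this is
    the cup product of the coboundaries of the [y c], for c in s, evaluated on
    the cube with base point z and directions S: a sum over all monotone paths
    from z to the opposite corner of this cube. *)
Fixpoint dcup (s : seq 'I_n) (z : point) (S : {set 'I_n}) : bool :=
  if s is c :: s' then
    \sum_(i in S) (y c z + y c (gstep z i)) * dcup s' (gstep z i) (S :\ i)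
  else 1.

(** Modulo 2, the terms for (i, j) and (j, i) cancel. *)
Lemma sum_offdiag_sym (S : {set 'I_n}) (g : 'I_n -> 'I_n -> bool) :
  (forall i j, g i j = g j i) ->
  \sum_(i in S) \sum_(j in S :\ i) g i j = 0.
Proof.
move=> gC.
have E i : i \in S -> \sum_(j in S :\ i) g i j =
   \sum_(j in S | (i < j)%N) g i j + \sum_(j in S | (j < i)%N) g i j.
  move=> iS; rewrite (bigID (fun j : 'I_n => (i < j)%N)) /=.
  congr (_ + _); apply: eq_bigl => j; rewrite !inE -?val_eqE /=;
    by case: ltngtP; rewrite ?andbT ?andbF.
rewrite (eq_bigr _ E) big_split /= [X in _ + X](exchange_big_dep (mem S)) /=; last first.
  by move=> i j _ /andP[].
rewrite [X in _ + X](_ : _ = \sum_(i in S) \sum_(j in S | (i < j)%N) g i j).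
  exact: addbb.
by apply: eq_bigr => i iS; apply: eq_big => [j|j _]; rewrite ?iS.
Qed.

(** A product of coboundaries is a closed cochain: its sum over the lower
    facets of a cube equals, modulo 2, its sum over the upper facets. This is the
    Leibniz rule, proved by induction on the number of factors. *)
Lemma dcup_closed s (z : point) (S : {set 'I_n}) :
  \sum_(i in S) dcup s z (S :\ i) = \sum_(i in S) dcup s (gstep z i) (S :\ i).
Proof.
elim: s z S => [//|c s IH] z S /=.
pose T w i j := dcup s (gstep (gstep w i) j) (S :\ i :\ j).
have TC w i j : T w i j = T w j i.
  by rewrite /T gstepC; congr dcup; apply/setP => k; rewrite !inE andbCA.
have comm2 f1 : \sum_(i in S) \sum_(j in S :\ i) f1 i j =
    \sum_(j in S) \sum_(i in S :\ j) f1 i j :> bool.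
  rewrite (exchange_big_dep (mem S)) /=; last by move=> i j _ /setD1P[].
  apply: eq_bigr => j jS; apply: eq_bigl => i.
  by rewrite !inE eq_sym jS andbT andbC.
transitivity (\sum_(i in S) \sum_(j in S :\ i)
    (y c z + y c (gstep z i)) * dcup s (gstep z i) (S :\ i :\ j)).
  rewrite comm2; apply: eq_bigr => i iS; apply: eq_bigr => j /setD1P[ji jS].
  by congr (_ * dcup _ _ _); apply/setP => k; rewrite !inE andbCA.
(* The values of the label at the far corner are symmetric in i and j. *)
transitivity (\sum_(i in S) (\sum_(j in S :\ i) y c (gstep (gstep z i) j) * T z i j
    + \sum_(j in S :\ i) y c (gstep z i) * T z i j)); last first.
  apply: eq_bigr => i iS; rewrite -big_split /=; apply: eq_bigr => j _.
  by rewrite mulrDl addrC.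
rewrite big_split /= [X in _ = X + _]sum_offdiag_sym ?add0r; last first.
  by move=> i j /=; rewrite gstepC TC.
under eq_bigr => i iS.
  under eq_bigr do rewrite mulrDl.
  rewrite big_split /= -!mulr_sumr IH; over.
rewrite big_split /= -mulr_sumr (@sum_offdiag_sym S (T z)) //.
rewrite mulr0 add0r; apply: eq_bigr => i _; rewrite mulr_sumr //.
Qed.

(** The product starting with the coboundary of [y c] is itself a coboundary,
    that of [y c] times the remaining factors, since these are closed. *)
Lemma dcup_dE c s (z : point) (S : {set 'I_n}) :
  dcup (c :: s) z S = \sum_(i in S) (y c z * dcup s z (S :\ i) +
     y c (gstep z i) * dcup s (gstep z i) (S :\ i)).
Proof.
rewrite /= big_split /= -mulr_sumr dcup_closed mulr_sumr -big_split /=.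
by apply: eq_bigr => i _; rewrite mulrDl.
Qed.

(** Discrete fundamental theorem of calculus in the direction i; Q is a condition
    on the other coordinates. *)
Lemma gstep_telescope (i : 'I_n) (Q : pred point) (g : point -> bool) :
  (forall z, Q (gstep z i) = Q z) ->
  \sum_(z | Q z && (z i < N)%N) (g z + g (gstep z i)) =
  \sum_(z | Q z && (z i == 0 :> nat)) g z +
  \sum_(z | Q z && (z i == N :> nat)) g z.
Proof.
move=> Qi; rewrite big_split /=.
have -> : \sum_(z | Q z && (z i < N)%N) g (gstep z i) =
          \sum_(z | Q z && (0 < z i)%N) g z.
  rewrite [RHS](reindex_inj (@gstep_inj i)) /=; apply: eq_bigl => z.
  rewrite Qi ffunE eqxx /=; congr (_ && _).
  have := ltn_ord (z i); rewrite ltnS leq_eqVlt => /predU1P[->|zN].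
    by rewrite modnn ltnn.
  by rewrite zN modn_small.
rewrite !big_mkcondr /= -!big_split /=; apply: eq_bigr => z _.
have := ltn_ord (z i); rewrite ltnS leq_eqVlt => /predU1P[->|zN].
  by rewrite ltnn eqxx N_gt0 gtn_eqF.
by rewrite zN (ltn_eqF zN) lt0n; case: eqP => //= _; case: (g z).
Qed.

Hypothesis y0 : forall (c : 'I_n) (z : point), z c = 0 :> nat -> y c z = false.
Hypothesis yN : forall (c : 'I_n) (z : point), z c = N :> nat -> y c z = true.

(** On a face where the i-th coordinate is extreme, [y i] is constant, so a
    product that contains its coboundary vanishes. *)
Lemma dcup_face s (z : point) (S : {set 'I_n}) i : i \in s -> i \notin S ->
  z i = 0 :> nat \/ z i = N :> nat -> dcup s z S = 0.
Proof.
elim: s z S => [//|c s IH] z S + iS zi /=.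
have zj j : j \in S -> gstep z j i = z i.
  by rewrite ffunE; case: eqP => // <- jS; rewrite jS in iS.
rewrite inE => /predU1P[<-|si]; rewrite big1 // => j jS.
  have zj' : gstep z j i = z i :> nat by rewrite zj.
  by case: zi => zi; rewrite zi in zj'; [rewrite !y0|rewrite !yN].
by rewrite IH ?mulr0 ?zj// !inE negb_and iS orbT.
Qed.

(** The lower corners of the cubes with directions S that lie in the face where
    all the coordinates outside S equal N. *)
Definition gbox (S : {set 'I_n}) (z : point) : bool :=
  [forall j, if j \in S then z j < N else z j == N :> nat]%N.

Lemma gboxP (S : {set 'I_n}) (z : point) : reflect
  (forall j, (if j \in S then z j < N else z j == N :> nat)%N) (gbox S z).
Proof. exact: forallP. Qed.

(** Stokes' formula, by induction on the dimension. The sum over the grid of the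
    coboundary given by [dcup_dE] reduces to the boundary of the grid; there,
    the boundary conditions on the labels kill all faces except the one where
    the c-th coordinate is N, whose contribution is the same sum in one
    dimension less. *)
Lemma grid_degree s : uniq s ->
  \sum_(z | gbox [set i in s] z) dcup s z [set i in s] = 1.
Proof.
elim: s => [_|c s IH]; last rewrite cons_uniq => /andP[cs us].
  rewrite (big_pred1 [ffun => ord_max]) //= => z.
  apply/gboxP/eqP => [H|-> j]; last by rewrite inE ffunE /=.
  by apply/ffunP => j; rewrite ffunE; apply/val_inj/eqP => /=; have := H j; rewrite inE.
set S := [set i in c :: s].
under eq_bigr do rewrite dcup_dE.
rewrite exchange_big /= (bigD1 c) /=; last by rewrite !inE eqxx.
pose Q i (z : point) := [forall j, (j != i) ==> (if j \in S then z j < N else z j == N :> nat)]%N.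
have Qs i z : Q i (gstep z i) = Q i z.
  apply: eq_forallb => j; rewrite ffunE.
  by case: (j == i).
have SQ i z : i \in S -> gbox S z = Q i z && (z i < N)%N.
  move=> iS; apply/gboxP/andP => [H|[/forallP H zi] j].
    split; last by have := H i; rewrite iS.
    by apply/forallP => j; apply/implyP => _; exact: H.
  by have := H j; case: eqP => [-> _|]//; rewrite iS.
have cS : c \in S by rewrite !inE eqxx.
(* Faces transverse to a direction i other than c contribute nothing. *)
rewrite [X in _ + X]big1 ?addr0; last first.
  move=> i /andP[iS ic]; rewrite (eq_bigl _ _ (fun z => SQ i z iS)).
  rewrite (@gstep_telescope i (Q i) (fun z => y c z * dcup s z (S :\ i)))//.
  have si : i \in s by move: iS; rewrite !inE (negPf ic).
  by rewrite !big1 // => z /andP[_ /eqP zi]; rewrite (@dcup_face _ _ _ i)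
    ?mulr0 ?setD11 //; [right|left].
rewrite (eq_bigl _ _ (fun z => SQ c z cS)).
rewrite (@gstep_telescope c (Q c) (fun z => y c z * dcup s z (S :\ c)))//.
rewrite big1 ?add0r; last by move=> z /andP[_ /eqP zi]; rewrite y0 ?mul0r.
rewrite -[RHS](IH us).
have ScE : S :\ c = [set i in s].
  by apply/setP => i; rewrite !inE; case: eqP => //= ->; rewrite (negPf cs).
rewrite ScE; apply: eq_big => [z|z /andP[_ /eqP zc]]; last by rewrite yN// mul1r.
apply/andP/gboxP => [[/forallP H zc] j|H].
  have := H j; rewrite !inE; case: eqP => [->|_]//=.
  by rewrite (negPf cs).
split; last by have := H c; rewrite inE (negPf cs).
by apply/forallP => j; apply/implyP => jc; have := H j; rewrite !inE (negPf jc).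
Qed.

Definition gcube (z w : point) : Prop := forall j, (z j <= w j <= (z j).+1)%N.

(** A nonzero product contains a monotone path whose k-th step changes the k-th
    label of the sequence s. *)
Lemma dcup_cube (z0 : point) s (z : point) (S : {set 'I_n}) : dcup s z S -> gcube z0 z ->
  (forall j, j \in S -> z j = z0 j /\ (z0 j < N)%N) ->
  forall c, c \in s -> exists w w',
   [/\ gcube z0 w, gcube z0 w', y c w = false & y c w' = true].
Proof.
elim: s z S => [//|c s IH] z S /= dz zz0 zS c'.
have [i iS /andP[]] : exists2 i, i \in S &
    (y c z + y c (gstep z i)) && dcup s (gstep z i) (S :\ i).
  apply/exists_inP; apply: contraPT dz => /exists_inPn H.
  by rewrite big1 // => i /H /negPf.
have zi : gcube z0 (gstep z i).
  move=> j; rewrite ffunE; case: eqP => [->|_]; last exact: zz0.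
  have [-> iN] := zS i iS.
  by rewrite /= modn_small ?ltnS// leqnSn leqnn.
move=> yc di; rewrite inE => /predU1P[->|]; last first.
  apply: IH di zi _ c' => j /setD1P[ji jS].
  by rewrite ffunE (negPf ji); exact: zS.
move: yc; case yz: (y c z); case yzi: (y c (gstep z i)) => // _.
- by exists (gstep z i), z.
- by exists z, (gstep z i).
Qed.

(** A version of Sperner's lemma: some cube sees both values of every label. *)
Lemma grid_cube : exists z : point, forall c, exists w w',
   [/\ gcube z w, gcube z w', y c w = false & y c w' = true].
Proof.
have := grid_degree (enum_uniq 'I_n); set S := [set i in _] => deg.
have [z zS|H] := pickP (fun z => gbox S z && dcup (enum 'I_n) z S); last first.
  by move: deg; rewrite big1 // => z zS; have := H z; rewrite zS.
move: zS => /andP[/gboxP zS dz]; exists z => c.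
apply: (dcup_cube dz); last by rewrite mem_enum.
  by move=> j; rewrite leqnn leqnSn.
by move=> j jS; split=> //; have := zS j; rewrite jS.
Qed.

End GridDegree.

(** * The Poincare-Miranda theorem and zeros of outward fields *)

Section PoincareMiranda.
Variables (R : realType) (n : nat).

(** The labels record on which side of 0 each component lies at the points of a
    grid of mesh 2 r / (k + 1). By [grid_cube] some cube of this mesh sees both
    sides for every component, and an accumulation point of these cubes is a
    common zero. *)
Lemma poincare_miranda (r : R) (f : 'I_n -> 'rV[R]_n -> R) : 0 < r ->
  (forall i, continuous (f i)) ->
  (forall i (x : 'rV[R]_n), x ord0 i = - r -> f i x <= 0) ->
  (forall i (x : 'rV[R]_n), x ord0 i = r -> 0 <= f i x) ->
  exists x, forall i, f i x = 0.
Proof.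
move=> r0 fc fle fge.
pose h k (z : {ffun 'I_n -> 'I_k.+2}) : 'rV[R]_n :=
  \row_j (- r + (r *+ 2) / k.+1%:R * (z j)%:R).
(* The labels are forced on the extreme faces; by the sign conditions there,
   this is consistent with the signs of f. *)
pose y k (c : 'I_n) (z : {ffun 'I_n -> 'I_k.+2}) :=
  (z c == k.+1 :> nat) || ((z c != 0 :> nat) && (0 < f c (h k z))).
have hN k (c : 'I_n) (z : {ffun 'I_n -> 'I_k.+2}) :
    z c = k.+1 :> nat -> h k z ord0 c = r.
  by move=> zc; rewrite !mxE zc mulfVK ?pnatr_eq0// mulr2n addrA addNr add0r.
have y_le k c (z : {ffun 'I_n -> 'I_k.+2}) : y k c z = false -> f c (h k z) <= 0.
  move=> /norP[_]; rewrite negb_and negbK => /orP[/eqP zc|]; last by rewrite leNgt.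
  by apply: fle; rewrite !mxE zc mulr0 addr0.
have y_ge k c (z : {ffun 'I_n -> 'I_k.+2}) : y k c z = true -> 0 <= f c (h k z).
  move=> /orP[/eqP zc|/andP[_ /ltW//]].
  by apply: fge; exact: hN.
have Hex : forall k, exists z : {ffun 'I_n -> 'I_k.+2},
  forall c, exists w w',
   [/\ gcube z w, gcube z w', y k c w = false & y k c w' = true].
  move=> k; apply: (@grid_cube n k.+1) => // c z zc; rewrite /y zc //=.
  by rewrite eqxx.
pose z k := sval (cid (Hex k)).
have Hz k : forall c, exists w w',
   [/\ gcube (z k) w, gcube (z k) w', y k c w = false & y k c w' = true].
  exact: svalP (cid (Hex k)).
have h_near k (w : {ffun 'I_n -> 'I_k.+2}) e : gcube (z k) w ->
    (r *+ 2) / k.+1%:R < e -> ball (h k (z k)) e (h k w).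
  move=> zw ke; have e0 : 0 < e.
    by apply: le_lt_trans ke; rewrite divr_ge0// mulrn_wge0// ltW.
  split => // i j; rewrite (ord1 i) /ball /= !mxE.
  have /andP[zl zu] := zw j.
  rewrite opprD addrACA addrN add0r -mulrBr normrM ger0_norm; last first.
    by rewrite divr_ge0// mulrn_wge0// ltW.
  apply: le_lt_trans ke; rewrite ler_piMr ?divr_ge0 ?mulrn_wge0 ?(ltW r0)//.
  rewrite distrC -natrB// normr_nat -[1]/(1%:R) ler_nat.
  by rewrite leq_subLR addn1.
pose K := [set x : 'rV[R]_n | forall i, x ord0 i \in `[- r, r]].
have Kc : compact K.
  apply: (@rV_compact _ _ (fun=> `[- r, r]%classic)).
  by move=> _; exact: segment_compact.
have [] := Kc ((fun k => h k (z k)) @ \oo) _.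
  rewrite /fmap /=; near=> k => i; rewrite in_itv /= !mxE.
  rewrite lerDl mulr_ge0 ?ler0n ?divr_ge0 ?mulrn_wge0 ?(ltW r0)//=.
  rewrite -[leRHS](hN k i [ffun=> ord_max]) ?ffunE// !mxE ffunE.
  by rewrite lerD2l ler_wpM2l ?divr_ge0 ?mulrn_wge0 ?(ltW r0)// ler_nat leq_ord.
move=> x [Kx clx]; exists x => c.
have close (A : set 'rV[R]_n) : nbhs x A -> exists k,
    forall w, gcube (z k) w -> A (h k w).
  move=> /nbhs_ballP[e /= e0 eA].
  have [] := clx [set x' | exists2 k, (r *+ 2) / k.+1%:R < e / 2 & x' = h k (z k)]
    (ball x (e / 2)).
  - rewrite /fmap /=; near=> k; exists k => //=.
    rewrite ltr_pdivrMr ?ltr0n// mulrC -ltr_pdivrMr ?divr_gt0//.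
    rewrite (@lt_le_trans _ _ k%:R) ?ler_nat//.
    by near: k; exact: nbhs_infty_gtr.
  - by apply: nbhsx_ballx; rewrite divr_gt0.
  move=> _ [[k kr ->] xk]; exists k => w zw; apply: eA.
  by rewrite (splitr e); apply: ball_triangle xk (h_near _ _ _ zw kr).
have fcx := fc c x.
apply/eqP; rewrite eq_le !leNgt; apply/andP; split; apply/negP => fx.
  have /close[k] : \forall x' \near x, 0 < f c x' by exact: (cvgr_gt (f c x) fcx).
  have [w [_ [zw _ /y_le wle _]]] := Hz k c.
  by move=> /(_ _ zw) /=; rewrite ltNge wle.
have /close[k] : \forall x' \near x, f c x' < 0 by exact: (cvgr_lt (f c x) fcx).
have [_ [w [_ zw _ /y_ge wle]]] := Hz k c.
by move=> /(_ _ zw) /=; rewrite ltNge wle.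
Unshelve. all: by end_near. Qed.

(** This is Brouwer's theorem for x - T x followed by the projection onto the
    cube, in the form of [poincare_miranda]. A fixed point of that map satisfies
    T i x * x i <= 0 for all i, and could fail to be a zero of T only on the
    boundary of the cube, where the hypothesis excludes it. *)
Lemma zero_of_outward_field (r : R) (T : 'I_n -> 'rV[R]_n -> R) : 0 < r ->
  (forall i, continuous (T i)) ->
  (forall x : 'rV[R]_n, (exists i, `|x ord0 i| = r) ->
     0 < \sum_i T i x * x ord0 i) ->
  exists x, forall i, T i x = 0.
Proof.
move=> r0 Tc Tpos.
pose clamp t : R := Num.max (- r) (Num.min r t).
pose f (i : 'I_n) (x : 'rV[R]_n) : R := x ord0 i - clamp (x ord0 i - T i x).
have cc : continuous clamp.
  move=> t; apply: (@continuous_max _ _ (fun=> - r) (fun t => Num.min r t)).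
    exact: cst_continuous.
  apply: (@continuous_min _ _ (fun=> r) id); first exact: cst_continuous.
  exact: cvg_id.
have fc i : continuous (f i).
  move=> x; pose pr (x : 'rV[R]_n) : R := x ord0 i.
  have prc : {for x, continuous pr} by exact: coord_continuous.
  have argc : {for x, continuous (fun x => pr x - T i x)}.
    by apply: (cvgB prc); exact: Tc.
  by apply: (cvgB prc); exact: (continuous_comp argc (cc _)).
have [i x xi|i x xi|x fx] := @poincare_miranda r f r0 fc.
- by rewrite /f subr_le0 xi /clamp le_max lexx.
- by rewrite /f subr_ge0 xi /clamp ge_max ge_min lexx andbT; lra.
have clampE t : [\/ clamp t = t, clamp t = r /\ r <= t | clamp t = - r /\ t <= - r].
  rewrite /clamp; case: (lerP r t) => rt.
    by rewrite max_r; [constructor 2|lra].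
  by case: (lerP (- r) t) => tr; [constructor 1|constructor 3; rewrite ltW].
have xE i : T i x = 0 \/ `|x ord0 i| = r /\ T i x * x ord0 i <= 0.
  have /eqP := fx i; rewrite /f subr_eq0 => /eqP xi.
  case: (clampE (x ord0 i - T i x)) => [E|[E t]|[E t]]; rewrite E in xi.
  - left; lra.
  - by right; rewrite xi gtr0_norm// pmulr_lle0//; split=> //; lra.
  - right; rewrite xi normrN gtr0_norm// mulrN oppr_le0 mulr_ge0// ?(ltW r0)//.
    by lra.
exists x => i; have [//|[xi _]] := xE i.
have := Tpos x (ex_intro _ i xi); rewrite ltNge sumr_le0// => j _.
by have [->|[_]//] := xE j; rewrite mul0r.
Qed.

End PoincareMiranda.

(** * The Hahn-Banach theorem *)

Section HahnBanach.
Variables (R : realType) (E : lmodType R) (q : E -> R).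
Hypothesis q_sub : forall x y, q (x + y) <= q x + q y.
Hypothesis q_hom : forall k x, 0 <= k -> q (k *: x) = k * q x.

Let q0 : q 0 = 0.
Proof. by rewrite -(scale0r 0) q_hom// mul0r. Qed.

(** Partial functionals are represented by their graphs. Domination by q forces
    a linear graph to be functional, since q 0 = 0. *)
Definition dominated_graph (B : set (E * R^o)) : Prop :=
  (forall (k : R) u v, B u -> B v -> B (k *: u + v)) /\
  (forall u, B u -> u.2 <= q u.1).

Let extend_graph (B : set (E * R^o)) (x0 : E) (c : R) : set (E * R^o) :=
  [set u | exists v, exists2 t : R, B v & u = v + t *: (x0, c)].

(** The one-dimensional step of Hahn-Banach: the value c at x0 must lie between
    the numbers u.2 - q (u.1 - x0) and the numbers q (v.1 + x0) - v.2, and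
    subadditivity of q leaves room for it. *)
Lemma dominated_graph_extend (B : set (E * R^o)) x0 : B 0 -> dominated_graph B ->
  exists c, dominated_graph (extend_graph B x0 c).
Proof.
move=> B0 [Bl Bq].
have lu u v : B u -> B v -> u.2 - q (u.1 - x0) <= q (v.1 + x0) - v.2.
  move=> Bu Bv; have := Bq _ (Bl 1 _ _ Bu Bv); rewrite scale1r /=.
  have := q_sub (u.1 - x0) (v.1 + x0); rewrite addrACA addNr addr0.
  lra.
pose S := [set u.2 - q (u.1 - x0) | u in B].
have S0 : S !=set0 by exists (0 - q (0 - x0)), 0.
have ubS v : B v -> ubound S (q (v.1 + x0) - v.2).
  by move=> Bv _ [u Bu <-]; exact: lu.
have supS : has_sup S by split => //; exists (q (0 + x0) - 0); exact: (ubS 0).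
exists (sup S); split.
  move=> k _ _ [u [s Bu ->]] [v [t Bv ->]].
  exists (k *: u + v), (k * s + t); first exact: Bl.
  by rewrite scalerDr scalerDl scalerA addrACA.
have Bs (k : R) u : B u -> B (k *: u) by move=> Bu; rewrite -[_ *: _]addr0; exact: Bl.
move=> _ [v [t Bv ->]] /=.
have [t0|t0|->] := ltgtP t 0; last by rewrite !scale0r !addr0; exact: Bq.
  have : (- t^-1 *: v).2 - q ((- t^-1 *: v).1 - x0) <= sup S.
    by apply: (sup_upper_bound supS); exists (- t^-1 *: v) => //; exact: Bs.
  have -> : v.1 + t *: x0 = (- t) *: ((- t^-1 *: v).1 - x0).
    rewrite /= scalerBr scalerA scaleNr opprK mulrNN divff ?lt_eqF// scale1r.
    by [].
  rewrite q_hom ?oppr_ge0 ?(ltW t0)//; set Q := q _ => /= H.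
  have : (- t) * (- t^-1 * v.2 - Q) <= (- t) * sup S by rewrite ler_pM2l ?oppr_gt0.
  rewrite mulrBr mulrA mulrNN divff ?lt_eqF// mul1r -[t *: sup S]/(t * sup S); lra.
have : sup S <= q ((t^-1 *: v).1 + x0) - (t^-1 *: v).2.
  by apply: ge_sup => //; apply: ubS; exact: Bs.
have -> : v.1 + t *: x0 = t *: ((t^-1 *: v).1 + x0).
  by rewrite /= scalerDr scalerA divff ?gt_eqF// scale1r.
rewrite q_hom ?(ltW t0)//; set Q := q _ => /= H.
have : t * sup S <= t * (Q - t^-1 * v.2) by rewrite ler_pM2l.
rewrite mulrBr mulrA divff ?gt_eqF// mul1r -[t *: sup S]/(t * sup S); lra.
Qed.

Theorem hahn_banach (B0 : set (E * R^o)) : B0 0 -> dominated_graph B0 ->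
  exists F : {linear E -> R^o},
    (forall u, B0 u -> F u.1 = u.2) /\ forall x, F x <= q x.
Proof.
move=> B00 B0g.
pose P (A : set (E * R^o)) := dominated_graph (A `|` B0).
have [] := @Zorn_bigcup _ P.
  move=> FF FP Ftot; split.
    move=> k u v Hu Hv.
    have [A FA [Au Av]] : exists2 A, FF A \/ A = set0 & (A `|` B0) u /\ (A `|` B0) v.
      case: Hu => [[A FA Au]|Bu]; case: Hv => [[A' FA' Av]|Bv].
      - by have [AA|AA] := Ftot _ _ FA FA'; [exists A'|exists A];
          do ?[by left]; split; left => //; exact: AA.
      - by exists A; [left|split; [left|right]].
      - by exists A'; [left|split; [right|left]].
      - by exists set0; [right|split; right].
    have [PA _] : P A by case: FA => [/FP//|->]; rewrite /P set0U.
    have := PA k u v Au Av; case: FA => [FA|->]; last by rewrite set0U; right.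
    by case => [?|?]; [left; exists A|right].
  move=> u [[A FA Au]|Bu]; last by have [_] := B0g; exact.
  by have [_] := FP _ FA; apply; left.
move=> A [PA Amax]; set B := A `|` B0.
have B_0 : B 0 by right.
have [Bl Bq] := PA; rewrite -/B in Bl Bq.
have Btot x : exists r, B (x, r).
  apply: contrapT => Bx; have [c Hc] := dominated_graph_extend x B_0 PA.
  have sub : B `<=` extend_graph B x c.
    by move=> u Bu; exists u, 0 => //; rewrite scale0r addr0.
  have xc : extend_graph B x c (x, c) by exists 0, 1 => //; rewrite scale1r add0r.
  apply: (Amax (extend_graph B x c)).
    split; first by move=> u Au; apply: sub; left.
    by move=> /(_ _ xc) Ax; apply: Bx; exists c; left.
  rewrite /P (_ : _ `|` _ = extend_graph B x c)//.
  by apply/seteqP; split => [u [//|Bu]|u ?]; [apply: sub; right|left].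
have Bfun x (r s : R) : B (x, r) -> B (x, s) -> r = s.
  move=> Br Bs.
  have H (t : R) : t * (r - s) <= 0.
    have Bd : B (0, r - s).
      rewrite (_ : (0, _) = -1 *: (x, s) + (x, r)); first exact: Bl.
      by congr (_, _); rewrite /= ?[_ *: s]mulN1r ?scaleN1r addrC ?subrr.
    by have := Bq _ (Bl t _ _ Bd B_0); rewrite addr0 /= scaler0 q0.
  have := H (r - s); rewrite -expr2 => H2; apply/eqP; rewrite -subr_eq0.
  by rewrite -sqrf_eq0 eq_le H2 sqr_ge0.
pose F x : R^o := sval (cid (Btot x)).
have FB x : B (x, F x) by exact: svalP (cid (Btot x)).
have Fl : linear F.
  by move=> k x z; apply: (Bfun (k *: x + z)) => //; exact: (Bl k (x, F x) (z, F z)).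
pose FL : {linear E -> R^o} := HB.pack F (GRing.isLinear.Build R E R^o _ F Fl).
exists FL; split=> [[x r] B0u|x] /=; last exact: (Bq (x, F x)).
by apply: (Bfun x) => //; right.
Qed.

End HahnBanach.

(** * Dual spaces, separation and uniform boundedness *)

Section DualBasics.
Variables (R : realType) (E : normedModType R).
Implicit Types (mu nu : dual E) (x y : E).

Lemma dual_of_bounded (F : {linear E -> R^o}) (M : R) :
  (forall x, `|F x| <= M * `|x|) -> exists mu : dual E, forall x, mu x = F x.
Proof.
move=> FM; have Fc : continuous F.
  apply/linear_bounded_continuous/bounded_funP => r.
  exists (`|M| * r) => x xr; apply: le_trans (FM x) _.
  by apply: le_trans (ler_norm _) _; rewrite normrM normr_id ler_wpM2l.
have FD : (F : E -> R^o) \in @is_dual R E by apply/asboolP; split => //; exact: linearP.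
by exists (Dual FD).
Qed.

Lemma dual_norm_bound mu : forall x, `|mu x| <= `|mu| * `|x|.
Proof. exact: le_dual_norm. Qed.

Lemma dual_norm_leP mu (M : R) : 0 <= M ->
  (forall x, `|mu x| <= M * `|x|) -> `|mu| <= M.
Proof.
move=> M0 H; apply: ge_sup; first by have [] := dual_norm_has_sup mu.
by move=> _ [x /= x1 <-]; apply: le_trans (H x) _; rewrite ler_piMr.
Qed.

Lemma dual_ext mu nu : (forall x, mu x = nu x) -> mu = nu.
Proof. by move=> H; apply/val_inj/funext. Qed.

Lemma dual0E x : (0 : dual E) x = 0. Proof. by []. Qed.
Lemma dualBE mu nu x : (mu - nu) x = mu x - nu x. Proof. by []. Qed.

(** The common construction of limit functionals: a pointwise limit of linear
    functionals bounded by M is again one. *)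
Lemma dual_of_limit {T : Type} (F : set_system T) {FF : ProperFilter F}
    (l : T -> E -> R) (lam : E -> R) (M : R) :
  (forall t (k : R) x y, l t (k *: x + y) = k * l t x + l t y) ->
  (forall x, l ^~ x @ F --> lam x) ->
  (\forall t \near F, forall x, `|l t x| <= M * `|x|) ->
  exists mu : dual E, forall x, mu x = lam x.
Proof.
move=> ll llam lM.
have laml : linear (lam : E -> R^o).
  move=> k x y; apply: (@cvg_unique _ _ (l ^~ (k *: x + y) @ F)) => //=.
  under eq_fun do rewrite ll.
  by apply: cvgD => //; apply: cvgM => //; exact: cvg_cst.
pose FL : {linear E -> R^o} := HB.pack lam (GRing.isLinear.Build R E R^o _ lam laml).
apply: (@dual_of_bounded FL M) => x /=.
have lamx : (fun t => `|l t x|) @ F --> `|lam x| by apply: cvg_norm; exact: llam.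
rewrite -(cvg_lim _ lamx)//; apply: limr_le; first exact: cvgP lamx.
by apply: filterS lM => t; exact.
Qed.

(** Both the existence of norming functionals and the separation of points from
    closed subspaces are instances, with q the norm and the distance to the
    subspace respectively. *)
Lemma exists_dual_seminorm (q : E -> R) (M : R) (x : E) :
  (forall y z, q (y + z) <= q y + q z) ->
  (forall k y, q (k *: y) = `|k| * q y) ->
  (forall y, q y <= M * `|y|) ->
  exists mu : dual E, mu x = q x /\ forall y, `|mu y| <= q y.
Proof.
move=> qD qZ qM.
have q_ge0 y : 0 <= q y.
  have := qD y (-1 *: y); rewrite scaleN1r subrr -(scale0r 0) qZ normr0 mul0r.
  by rewrite -scaleN1r qZ normrN normr1 mul1r; lra.
have qh k y : 0 <= k -> q (k *: y) = k * q y by move=> k0; rewrite qZ ger0_norm.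
(* The initial functional is t *: x |-> t * q x on the line through x. *)
have [||F [FB Fq]] := @hahn_banach R E q qD qh
  [set u | exists t : R, u = (t *: x, t * q x)].
- by exists 0; rewrite scale0r mul0r.
- split=> [k _ _ [s ->] [t ->]|_ [s ->]] /=.
    exists (k * s + t); rewrite scalerDl -scalerA mulrDl -mulrA.
    by [].
  by rewrite qZ ler_wpM2r// ler_norm.
have Fabs y : `|F y| <= q y.
  rewrite ler_norml Fq andbT lerNl -linearN; apply: le_trans (Fq _) _.
  by rewrite -scaleN1r qZ normrN normr1 mul1r.
have [mu muE] := @dual_of_bounded F M (fun y => le_trans (Fabs y) (qM y)).
exists mu; split=> [|y]; last by rewrite muE.
by rewrite muE (FB (x, q x))//; exists 1; rewrite scale1r mul1r.
Qed.

Lemma norming_functional x : exists2 mu : dual E, mu x = `|x| & `|mu| <= 1.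
Proof.
have [||y|mu [mux muq]] := @exists_dual_seminorm (fun y => `|y|) 1 x.
- exact: ler_normD.
- exact: normrZ.
- by rewrite mul1r.
- by exists mu => //; apply: dual_norm_leP => // y; rewrite mul1r.
Qed.

Lemma dual_separates_closed (S : set E) x : closed S -> S 0 ->
  (forall (k : R) y z, S y -> S z -> S (k *: y + z)) -> ~ S x ->
  exists2 mu : dual E, (forall y, S y -> mu y = 0) & mu x != 0.
Proof.
move=> Sc S0 Sl Sx.
have SZ (k : R) y : S y -> S (k *: y).
  by move=> Sy; rewrite -[_ *: _]addr0; exact: Sl.
have SD y z : S y -> S z -> S (y + z).
  by move=> Sy Sz; rewrite -[y]scale1r; exact: Sl.
pose dist z := inf [set `|z - y| | y in S].
have dist_inf z : has_inf [set `|z - y| | y in S].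
  by split; [exists `|z - 0|, 0|exists 0 => _ [y _ <-]].
have dist_le z y : S y -> dist z <= `|z - y|.
  by move=> Sy; apply: ge_inf; [have [] := dist_inf z|exists y].
have dist_ge z r : (forall y, S y -> r <= `|z - y|) -> r <= dist z.
  move=> H; apply: lb_le_inf; first by have [] := dist_inf z.
  by move=> _ [y Sy <-]; exact: H.
have dist_lt z e : dist z < e -> exists2 y, S y & `|z - y| < e.
  by move=> /inf_lt[|_ [y Sy <-] ye]; [have [] := dist_inf z|exists y].
have distZ_le k z : dist (k *: z) <= `|k| * dist z.
  have [->|k0] := eqVneq k 0.
    rewrite scale0r normr0 mul0r; apply: le_trans (dist_le 0 0 S0) _.
    by rewrite subrr normr0.
  rewrite mulrC -ler_pdivrMr ?normr_gt0//; apply: dist_ge => y Sy.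
  rewrite ler_pdivrMr ?normr_gt0// mulrC -normrZ scalerBr.
  by apply: dist_le; exact: SZ.
have [||y|mu [mux muq]] := @exists_dual_seminorm dist 1 x.
- move=> y z; apply/ler_addgt0Pr => e e0.
  have [y' Sy' ye] : exists2 y', S y' & `|y - y'| < dist y + e / 2.
    by apply: dist_lt; rewrite ltrDl divr_gt0.
  have [z' Sz' ze] : exists2 z', S z' & `|z - z'| < dist z + e / 2.
    by apply: dist_lt; rewrite ltrDl divr_gt0.
  apply: le_trans (dist_le _ _ (SD _ _ Sy' Sz')) _.
  rewrite opprD addrACA; apply: le_trans (ler_normD _ _) _; lra.
- move=> k z; apply/eqP; rewrite eq_le distZ_le /=.
  have [->|k0] := eqVneq k 0.
    by rewrite normr0 mul0r scale0r; apply: dist_ge.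
  rewrite mulrC -ler_pdivlMr ?normr_gt0// -normfV mulrC.
  by rewrite -[X in dist X <= _](scalerK k0) distZ_le.
- by have := dist_le y 0 S0; rewrite subr0 mul1r.
exists mu => [y Sy|].
  apply/eqP; rewrite -normr_le0; apply: le_trans (muq y) _.
  by apply: le_trans (dist_le y y Sy) _; rewrite subrr normr0.
rewrite mux; apply: contra_notN Sx => /eqP dx; apply: Sc => A.
move=> /nbhs_ballP[e /= e0 eA].
have [|y Sy ye] := dist_lt x e; first by rewrite dx.
by exists y; split => //; apply: eA; rewrite -ball_normE.
Qed.

End DualBasics.

Section DualComplete.
Variables (R : realType) (E : normedModType R).

Lemma dual_cauchy_cvg (F : set_system (dual E)) : ProperFilter F ->
  cauchy F -> cvg F.
Proof.
move=> FF Fc.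
have Fb e : 0 < e -> exists mu : dual E, \forall nu \near F, `|mu - nu| < e.
  move=> e0; have /cauchyP/(_ e e0)[mu Hmu] := Fc; exists mu.
  by move: Hmu; rewrite -ball_normE.
have ev x : cvg ((fun mu : dual E => mu x : R) @ F).
  apply: cauchy_cvg; apply/cauchyP => e e0.
  have x1 : 0 < `|x| + 1 by rewrite ltr_wpDl.
  have [mu Hmu] := Fb (e / (`|x| + 1)) (divr_gt0 e0 x1).
  exists (mu x); rewrite /fmap /=; apply: filterS Hmu => nu.
  rewrite ltr_pdivlMr// => Hnu; rewrite -ball_normE /ball_ /= -dualBE.
  apply: le_lt_trans (dual_norm_bound _ _) _; apply: le_lt_trans Hnu.
  by rewrite ler_wpM2l// lerDl.
have [mu0 Hmu0] := Fb 1 ltr01.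
have [|||mu muE] := @dual_of_limit R E _ F FF (fun mu x => mu x)
  (fun x => lim ((fun mu : dual E => mu x : R) @ F)) (`|mu0| + 1).
- by move=> mu k x y; rewrite linearP.
- by move=> x; exact: ev.
- apply: filterS Hmu0 => nu Hnu x; apply: le_trans (dual_norm_bound _ _) _.
  rewrite ler_wpM2r// -lerBlDl; apply: le_trans (ltW Hnu).
  by rewrite distrC; apply: le_trans (lerB_dist _ _).
apply/cvg_ex; exists mu; apply/cvgrPdist_le => e e0.
have e20 : 0 < e / 2 by rewrite divr_gt0.
have [mu1 Hmu1] := Fb (e / 2) e20.
apply: filterS (Hmu1) => nu Hnu; apply: dual_norm_leP; first exact: ltW.
move=> x; rewrite dualBE muE.
have evx : (fun mu' : dual E => `|mu' x - nu x|) @ F -->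
    `|lim ((fun mu : dual E => mu x : R) @ F) - nu x|.
  by apply: cvg_norm; apply: cvgB; [exact: ev|exact: cvg_cst].
rewrite -(cvg_lim _ evx)//; apply: limr_le; first exact: cvgP evx.
apply: filterS Hmu1 => nu' Hnu'; rewrite -dualBE.
apply: le_trans (dual_norm_bound _ _) _; rewrite ler_wpM2r//.
rewrite -[nu'](subrK mu1) -addrA; apply: le_trans (ler_normD _ _) _.
rewrite distrC; lra.
Qed.

HB.instance Definition _ := Uniform_isComplete.Build (dual E) dual_cauchy_cvg.

(** Points of E act on the complete space [dual E], so that Banach-Steinhaus
    applies there; norming functionals turn the bound on this action into a bound
    on norms. *)
Lemma weakly_bounded_bounded (I : Type) (x : I -> E) :
  (forall mu : dual E, exists M : R, forall i, `|mu (x i)| <= M) ->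
  exists M : R, forall i, `|x i| <= M.
Proof.
move=> H; pose F : set (dual E -> R^o) := range (fun i (mu : dual E) => mu (x i) : R^o).
have [||M HM] := @Banach_Steinhauss R (dual E) R^o F _ _ 1.
- move=> _ [i _ <-]; split; last by [].
  move=> r; exists (r * `|x i|) => mu mur.
  by apply: le_trans (dual_norm_bound _ _) _; rewrite ler_wpM2r.
- by move=> mu; have [M HM] := H mu; exists M => _ [i _ <-].
exists M => i; have [mu <- mu1] := norming_functional (x i).
by rewrite (le_trans (ler_norm _))//; apply: (HM (fun mu : dual E => mu (x i))) => //; exists i.
Qed.

End DualComplete.

(** * Limits along ultrafilters *)

Section Ultra.

Lemma cvg_finer (T : Type) (X : topologicalType) (F G : set_system T)
    (g : T -> X) (l : X) : F `<=` G -> g @ F --> l -> g @ G --> l.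
Proof. by move=> FG gl A /gl; exact: FG. Qed.

(** Convergence along F can be tested on the ultrafilters that refine F: if it
    failed, some neighbourhood would be missed on a set that meets every member
    of F, and an ultrafilter would contain this set. *)
Lemma cvg_ultraP (T : Type) (X : topologicalType) (F : set_system T)
    (g : T -> X) (l : X) : Filter F ->
  (forall U : set_system T, UltraFilter U -> F `<=` U -> g @ U --> l) ->
  g @ F --> l.
Proof.
move=> FF H A Al; apply: contrapT => FA.
pose W := within (~` (g @^-1` A)) F.
have WP : ProperFilter W.
  apply: Build_ProperFilter.
  rewrite /W /within /= => F0; apply: FA; apply: filterS F0 => t /= nt.
  by apply: contrapT => /nt.
have [U [UU WU]] := ultraFilterLemma WP.
have FU : F `<=` U by move=> B FB; apply: WU; apply: filterS FB => t ? _.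
have UA : U (g @^-1` A) := H U UU FU A Al.
have UnA : U (~` (g @^-1` A)) by apply: WU; rewrite /W /within /=; apply: filterE.
by have [t []] := filter_ex (filterI UA UnA).
Qed.

Lemma compact_ultra_cvg (T : Type) (X : topologicalType) (U : set_system T)
    (K : set X) (g : T -> X) : UltraFilter U -> compact K ->
  (\forall t \near U, K (g t)) -> exists2 l, K l & g @ U --> l.
Proof.
move=> UU Kc gK; have [l [Kl cl]] := Kc (g @ U) _ gK.
exists l => // A Al; have [//|UnA] := in_ultra_setVsetC (g @^-1` A) UU.
by have [x []] := cl (~` A) A UnA Al.
Qed.

Variable R : realType.

Lemma bounded_ultra_cvg (T : Type) (U : set_system T) (g : T -> R) (M : R) :
  UltraFilter U -> (\forall t \near U, `|g t| <= M) -> cvg (g @ U).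
Proof.
move=> UU gM.
have [||l _ gl] := @compact_ultra_cvg T R U `[- M, M] g UU.
- exact: segment_compact.
- by apply: filterS gM => t gtM; rewrite /= in_itv /= -ler_norml.
- by apply/cvg_ex; exists l.
Qed.

(** Banach-Alaoglu: bounded real functions converge along an ultrafilter, so
    weak-star limits can be computed pointwise. *)
Lemma dual_weak_star_ultra (E : normedModType R) (T : Type) (U : set_system T)
    (mu : T -> dual E) (M : R) : UltraFilter U ->
  (\forall t \near U, `|mu t| <= M) ->
  exists nu : dual E, forall x, (fun t => mu t x : R) @ U --> (nu x : R).
Proof.
move=> UU muM.
have bnd : \forall t \near U, forall x, `|mu t x| <= M * `|x|.
  apply: filterS muM => t tM x.
  by apply: le_trans (dual_norm_bound _ _) _; rewrite ler_wpM2r.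
have ev x : cvg ((fun t => mu t x : R) @ U).
  apply: (bounded_ultra_cvg (M := M * `|x|)).
  by apply: filterS bnd => t; exact.
have [|||nu nuE] := @dual_of_limit R E T U _ (fun t => mu t)
  (fun x => lim ((fun t => mu t x : R) @ U)) M.
- by move=> t k x y; rewrite linearP.
- by move=> x; exact: ev.
- exact: bnd.
by exists nu => x; rewrite nuE; exact: ev.
Qed.

(** The points act on [dual E]; the weak-star limit of these actions is a point
    by reflexivity. *)
Lemma reflexive_weak_ultra (E : normedModType R) (T : Type) (U : set_system T)
    (x : T -> E) (M : R) : reflexive_space E -> UltraFilter U ->
  (\forall t \near U, `|x t| <= M) ->
  exists y : E, forall mu : dual E, (fun t => mu (x t) : R) @ U --> (mu y : R).
Proof.
move=> Er UU xM.
have evc t : exists Phi : dual (dual E),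
    (forall mu : dual E, Phi mu = mu (x t)) /\ `|Phi| <= `|x t|.
  pose ev (mu : dual E) : R^o := mu (x t).
  have evl : linear ev by [].
  pose evL : {linear dual E -> R^o} :=
    HB.pack ev (GRing.isLinear.Build R (dual E) R^o _ ev evl).
  have evb mu : `|evL mu| <= `|x t| * `|mu|.
    by rewrite mulrC; exact: dual_norm_bound.
  have [Phi PhiE] := dual_of_bounded evb; exists Phi; split=> [mu|].
    by rewrite PhiE.
  by apply: dual_norm_leP => // mu; rewrite PhiE.
have /choice[Phi PhiE] := evc.
have [|Psi PsiE] := @dual_weak_star_ultra (dual E) T U Phi M UU.
  by apply: filterS xM => t; apply: le_trans; have [] := PhiE t.
have [y Hy] := Er Psi; exists y => mu; rewrite -Hy.
apply: cvg_trans (PsiE mu); apply: near_eq_cvg; apply: filterE => t.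
by have [-> _] := PhiE t.
Qed.

End Ultra.

(** * Weak convergence of sequences *)

Section WeakSequences.
Variables (R : realType).

Lemma initial_topology_cvg (S : choiceType) (X : topologicalType) (g : S -> X)
    (T : Type) (F : set_system T) (u : T -> S) (x : S) : Filter F ->
  (g \o u) @ F --> g x ->
  (u : T -> initial_topology g) @ F --> (x : initial_topology g).
Proof.
move=> FF gu A; rewrite nbhsE => -[B [[C Co CB] Bx] BA].
have FC : F ((g \o u) @^-1` C).
  by apply: gu; apply: open_nbhs_nbhs; split => //; move: Bx; rewrite -CB.
have : F (u @^-1` A) by apply: filterS FC => t Ct; apply: BA; rewrite -CB.
by [].
Qed.

Lemma weakly_cvgP (E : normedModType R) (u : nat -> E) (x : E) :
  (forall mu : dual E, (fun m => mu (u m) : R) @ \oo --> (mu x : R)) ->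
  weakly_cvg u x.
Proof.
move=> H; apply: initial_topology_cvg; apply/pointwise_cvgP => mu.
exact: H.
Qed.

Lemma weak_star_continuous_apply (E F : normedModType R) (g : F -> dual E) :
  continuous (fun v => g v : weak_star E) -> forall x, continuous (fun v => g v x : R).
Proof.
move=> gc x v.
have /pointwise_cvgP/(_ x) : {ptws, (fun w => g w : E -> R^o) @ v --> (g v : E -> R^o)}.
  apply: cvg_comp; first exact: gc.
  exact: (@initial_continuous (dual E) {ptws E -> R^o} (fun mu => (mu : E -> R^o))).
exact.
Qed.

(** Functionals that norm the points of a dense sequence determine all
    points. *)
Lemma separable_total (E : normedModType R) : separable_space E ->
  exists xi : nat -> dual E, forall x, (forall n, xi n x = 0) -> x = 0.
Proof.
move=> [A Ac Ad].
have [g gA] : exists g : nat -> E, A `<=` range g.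
  by have /pcard_surjP[g] := Ac; exists g.
have /choice[xi Hxi] : forall n, exists mu : dual E, mu (g n) = `|g n| /\ `|mu| <= 1.
  by move=> n; have [mu] := norming_functional (g n); exists mu.
exists xi => x x0; apply/eqP; rewrite -normr_eq0 eq_le normr_ge0 andbT.
apply/ler_addgt0Pr => e e0; rewrite add0r.
have e20 : 0 < e / 2 by rewrite divr_gt0.
have [z [xy /gA[n _ gn]]] : (ball x (e / 2) `&` A) !=set0.
  by apply: Ad; [exists x; exact: ballxx|exact: ball_open].
move: xy; rewrite -{}gn -ball_normE /ball_ /= => xg.
have [H1 H2] := Hxi n.
have : `|g n| <= `|x - g n|.
  rewrite -[leLHS]normr_id -H1 -[xi n (g n)]subr0 -(x0 n) -linearB distrC.
  apply: le_trans (dual_norm_bound _ _) _; rewrite distrC; exact: ler_piMl.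
have := ler_normD (x - g n) (g n); rewrite subrK; lra.
Qed.

(** Along any finer ultrafilter the bounded sequence has a weak limit, and the
    functionals [xi n] identify it as x. *)
Lemma weakly_cvg_of_total (E : normedModType R) (xi : nat -> dual E)
    (u : nat -> E) (x : E) (M : R) : reflexive_space E ->
  (forall x, (forall n, xi n x = 0) -> x = 0) ->
  (forall m, `|u m| <= M) ->
  (forall n, (fun m => xi n (u m) : R) @ \oo --> (xi n x : R)) ->
  forall mu : dual E, (fun m => mu (u m) : R) @ \oo --> (mu x : R).
Proof.
move=> Er xi0 uM uxi mu; apply: cvg_ultraP => U UU ooU.
have [|y Hy] := reflexive_weak_ultra (M := M) (x := u) Er UU.
  by apply: filterE.
suff -> : x = y by exact: Hy.
apply/eqP; rewrite -subr_eq0; apply/eqP/xi0 => n; rewrite linearB.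
apply/eqP; rewrite subr_eq0; apply/eqP.
apply: (@cvg_unique _ _ ((fun m => xi n (u m) : R) @ U)) => //=.
exact: cvg_finer ooU (uxi n).
Qed.

(** Members of U are unbounded, so that increasing indices can be picked in a
    sequence of them. *)
Lemma ultra_subsequence (U : set_system nat) (A : nat -> set nat) :
  UltraFilter U -> \oo `<=` U -> (forall k, U (A k)) ->
  exists2 sigma : nat -> nat, {homo sigma : m n / (m < n)%N} &
    forall k, A k (sigma k).
Proof.
move=> UU ooU UA.
have next k N : exists m, (N < m)%N /\ A k m.
  have UN : U [set m | (N < m)%N] by apply: ooU; exists N.+1.
  by have [m [H1 H2]] := filter_ex (filterI UN (UA k)); exists m.
have /choice[nx Hnx] : forall p : nat * nat, exists m, (p.2 < m)%N /\ A p.1 m.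
  by move=> p; exact: next.
pose fix sigma k := if k is k'.+1 then nx (k, sigma k') else nx (0%N, 0%N).
exists sigma; last by case=> [|k] /=; [have [] := Hnx (0, 0)%N|have [] := Hnx (k.+1, sigma k)].
apply: homo_ltn => [|k]; first exact: ltn_trans.
by have [] := Hnx (k.+1, sigma k).
Qed.

End WeakSequences.

(** * Monotone operators *)

Section Minty.
Variables (R : realType) (E : normedModType R) (T : Type) (F : set_system T).
Context {FF : ProperFilter F}.

(** A bounded weak-star convergent family may be paired with a strongly
    convergent one. *)
Lemma cvg_pairing_strong (mu : T -> dual E) (x : T -> E) (y : E) (l M : R) :
  (\forall t \near F, `|mu t| <= M) -> x @ F --> y ->
  (fun t => mu t y : R) @ F --> l -> (fun t => mu t (x t) : R) @ F --> l.
Proof.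
move=> muM xy muy.
have -> : (fun t => mu t (x t) : R) = (fun t => mu t (x t - y) + mu t y).
  by apply/funext => t; rewrite -linearD subrK.
rewrite -[l]add0r; apply: cvgD => //.
have xy0 : (fun t => M * `|x t - y|) @ F --> (0 : R).
  rewrite -(mulr0 M) -(normr0 E) -(subrr y).
  by apply: cvgM; [exact: cvg_cst|apply: cvg_norm; apply: cvgB => //; exact: cvg_cst].
apply/norm_cvg0P; apply: (squeeze_cvgr _ (cvg_cst 0) xy0).
apply: filterS muM => t tM; rewrite normr_ge0 /=.
by apply: (le_trans (dual_norm_bound (mu t) _)); rewrite ler_wpM2r.
Qed.

Lemma cvg_pairing_dual (mu : T -> dual E) (nu : dual E) (x : T -> E) (l M : R) :
  (\forall t \near F, `|x t| <= M) -> mu @ F --> nu ->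
  (fun t => nu (x t) : R) @ F --> l -> (fun t => mu t (x t) : R) @ F --> l.
Proof.
move=> xM munu nux.
have -> : (fun t => mu t (x t) : R) = (fun t => (mu t - nu) (x t) + nu (x t)).
  by apply/funext => t; rewrite dualBE subrK.
rewrite -[l]add0r; apply: cvgD => //.
have xy0 : (fun t => `|mu t - nu| * M) @ F --> (0 : R).
  rewrite -(mul0r M) -(normr0 (dual E)) -(subrr nu).
  by apply: cvgM; [apply: cvg_norm; apply: cvgB => //; exact: cvg_cst|exact: cvg_cst].
apply/norm_cvg0P; apply: (squeeze_cvgr _ (cvg_cst 0) xy0).
apply: filterS xM => t tM; rewrite normr_ge0 /=.
by apply: (le_trans (dual_norm_bound (mu t - nu) _)); rewrite ler_wpM2l.
Qed.

Variables (A : T -> dual E) (B : T -> E -> dual E) (B' : E -> dual E).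
Variables (x : T -> E) (y : E) (chi : dual E) (l M : R).
Hypothesis mono : forall t w, 0 <= (A t - B t w) (x t - w).
Hypothesis Bcvg : forall w, B ^~ w @ F --> B' w.
Hypothesis xM : \forall t \near F, `|x t| <= M.
Hypothesis xy : forall mu : dual E, (fun t => mu (x t) : R) @ F --> (mu y : R).
Hypothesis Achi : forall w, (fun t => A t w : R) @ F --> (chi w : R).
Hypothesis Axl : (fun t => A t (x t) : R) @ F --> l.

(** The limit of the monotonicity inequality between x t and w. *)
Lemma minty_ineq w : 0 <= l - chi w - B' w (y - w).
Proof.
have Bw : (fun t => B t w (x t) : R) @ F --> (B' w y : R).
  exact: (@cvg_pairing_dual (B ^~ w) (B' w) x _ M xM (@Bcvg w) (@xy _)).
have Bww : (fun t => B t w w : R) @ F --> (B' w w : R).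
  apply: (@cvg_pairing_dual (B ^~ w) (B' w) (fun=> w) _ `|w|); last exact: cvg_cst.
    exact: filterE.
  exact: Bcvg.
have H : (fun t => (A t - B t w) (x t - w) : R) @ F --> l - chi w - B' w (y - w).
  rewrite linearB.
  have -> : (fun t => (A t - B t w) (x t - w) : R) =
      (fun t => (A t (x t) - A t w) - (B t w (x t) - B t w w)).
    by apply/funext => t; rewrite dualBE !linearB.
  exact: (cvgB (cvgB Axl (@Achi w)) (cvgB Bw Bww)).
rewrite -(cvg_lim _ H)//; apply: limr_ge; first exact: cvgP H.
exact: filterE.
Qed.

Lemma minty_liminf : chi y <= l.
Proof. by have := minty_ineq y; rewrite subrr linear0 subr0 subr_ge0. Qed.

Hypothesis hemi : forall w : E,
  (fun s : R => B' (y - s *: w) w : R) @ (0 : R) --> (B' y w : R).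

(** Minty's trick: in [minty_ineq], taken at y - s w with s > 0, divide by s and let
    s tend to 0. *)
Lemma minty_eq : l = chi y -> chi = B' y.
Proof.
move=> lE.
have le w : B' y w <= chi w.
  rewrite leNgt; apply/negP => Bw.
  have /nbhs_ballP[e /= e0 He] : nbhs (0 : R) [set s | chi w < B' (y - s *: w) w].
    exact: (cvgr_gt _ (@hemi w) _ Bw).
  have e20 : 0 < e / 2 by rewrite divr_gt0.
  have /He : ball 0 e (e / 2).
    rewrite -ball_normE /ball_ /= sub0r normrN gtr0_norm//.
    by rewrite gtr_pMr// invf_lt1 ?ltr1n.
  apply/negP; rewrite -leNgt.
  set s := e / 2 in e20 *.
  have chiE : chi (y - s *: w) = chi y - s * chi w by rewrite linearB linearZ.
  have BE z : B' z (s *: w) = s * B' z w by rewrite linearZ.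
  have := minty_ineq (y - s *: w).
  rewrite lE opprB addrCA subrr addr0 chiE BE opprB addrCA subrr addr0 -mulrBr.
  by rewrite pmulr_rge0// subr_ge0.
apply: dual_ext => w; apply/eqP; rewrite eq_le le andbT.
by have := le (- w); rewrite !linearN lerN2.
Qed.

End Minty.

Section Operators.
Variables (R : realType) (p : R) (L bL : normedModType R).
Variables (ba : L -> bL -> dual bL) (a : L -> dual L) (alphaU : R).
Hypotheses (hp : 1 < p) (alphaU_ge0 : 0 <= alphaU).

Lemma hemicontinuous_segment (E : normedModType R) (b : E -> dual E) (y w : E) :
  continuous (fun v => b v : weak_star E) ->
  (fun s : R => b (y - s *: w) w : R) @ (0 : R) --> (b y w : R).
Proof.
move=> /weak_star_continuous_apply/(_ w) bc.
have : (fun s : R => y - s *: w) @ (0 : R) --> y.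
  rewrite -[X in _ --> X]subr0 -(scale0r w).
  apply: cvgB; first exact: cvg_cst.
  by apply: cvgZr_tmp; exact: cvg_id.
by move=> H; exact: (cvg_comp _ _ H (bc y)).
Qed.

Lemma growth_bounded (A1 : assumption_A1 p ba alphaU) (M : R) :
  exists K, forall v w, `|v| <= M -> `|w| <= M -> `|ba v w| <= K.
Proof.
have [_ _ bnd] := A1.
exists (alphaU * (1 + M `^ (p - 1) + M `^ (p - 1))) => v w vM wM.
apply: le_trans (bnd v w) _; apply: ler_wpM2l => //.
have M0 : 0 <= M by exact: le_trans vM.
have p1 : 0 <= p - 1 by rewrite subr_ge0 ltW.
apply: lerD; [apply: lerD => //|]; apply: ge0_ler_powR => //;
  by rewrite nnegrE.
Qed.

(** The operator is continuous in each argument only. Along an ultrafilter, the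
    values have a weak-star limit chi, and monotonicity in the second argument
    identifies chi by [minty_eq]. *)
Lemma demicontinuous (A1 : assumption_A1 p ba alphaU) (A2 : assumption_A2 ba)
    (T : Type) (F : set_system T) (v : T -> L) (w : T -> bL) v0 w0 z :
  Filter F -> v @ F --> v0 -> w @ F --> w0 ->
  (fun t => ba (v t) (w t) z : R) @ F --> (ba v0 w0 z : R).
Proof.
move=> FF0 vv0 ww0; apply: cvg_ultraP => U UU FU.
have {}vv0 := cvg_finer FU vv0; have {}ww0 := cvg_finer FU ww0.
pose M := Num.max (`|v0| + 1) (`|w0| + 1).
have vM : \forall t \near U, `|v t| <= M.
  have : (fun t => `|v t|) @ U --> `|v0| by exact: cvg_norm.
  move/cvgr_le => /(_ (`|v0| + 1)); rewrite ltrDl ltr01 => /(_ isT).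
  by apply: filterS => t H; rewrite le_max H.
have wM : \forall t \near U, `|w t| <= M.
  have : (fun t => `|w t|) @ U --> `|w0| by exact: cvg_norm.
  move/cvgr_le => /(_ (`|w0| + 1)); rewrite ltrDl ltr01 => /(_ isT).
  by apply: filterS => t H; rewrite le_max H orbT.
have [K HK] := growth_bounded A1 M.
have bK : \forall t \near U, `|ba (v t) (w t)| <= K.
  by apply: filterS2 vM wM => t; exact: HK.
have [chi Hchi] := dual_weak_star_ultra UU bK.
suff <- : chi = ba v0 w0 by exact: Hchi.
have [A1s A1w _] := A1.
apply: (@minty_eq R bL T U _ (fun t => ba (v t) (w t)) (fun t => ba (v t)) _ w w0 chi
  (chi w0) M) => //.
- by move=> w'; exact: (cvg_comp v (fun u => ba u w') vv0 (A1s w' v0)).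
- by move=> mu; exact: (cvg_comp w mu ww0 (@dual_continuous _ _ mu w0)).
- exact: cvg_pairing_strong bK ww0 (Hchi _).
- by move=> w'; exact: hemicontinuous_segment.
Qed.

End Operators.

(** * The seminorm induced by V *)

Section SeminormV.
Variables (R : realType) (L : normedModType R) (V : submodClosed (dual L)).
Implicit Types u v : L.

Let Q u := [set `|mu u| / `|mu| | mu in [set mu : dual L | mu \in V /\ mu != 0]].

Let Q_le u r : Q u r -> r <= `|u|.
Proof.
move=> [mu [_ mu0] <-]; rewrite ler_pdivrMr ?normr_gt0// mulrC.
exact: dual_norm_bound.
Qed.

(** The supremum that defines the seminorm is over the empty set when V is trivial,
    and is then 0 by convention; otherwise it is a genuine supremum. *)
Lemma seminormV_case :
  (forall u, seminormV V u = 0) \/ (forall u, has_sup (Q u)).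
Proof.
have [[mu muV]|H] := pselect (exists mu : dual L, mu \in V /\ mu != 0).
  by right=> u; split; [exists (`|mu u| / `|mu|), mu|exists `|u| => r /Q_le].
left=> u; rewrite /seminormV (_ : [set _ | _ in _] = set0) ?sup0//.
by apply/seteqP; split=> // r [mu muV _]; apply: H; exists mu.
Qed.

Lemma seminormV_le u : seminormV V u <= `|u|.
Proof.
have [->//|H] := seminormV_case; apply: ge_sup; first by have [] := H u.
by move=> r /Q_le.
Qed.

Lemma seminormV_ge0 u : 0 <= seminormV V u.
Proof.
have [->//|H] := seminormV_case; have [[r Qr] _] := H u.
have := sup_upper_bound (H u) Qr; apply: le_trans.
by case: Qr => mu _ <-; rewrite divr_ge0.
Qed.

Lemma seminormVD u v : seminormV V (u + v) <= seminormV V u + seminormV V v.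
Proof.
have [H|H] := seminormV_case; first by rewrite !H addr0.
apply: ge_sup; first by have [] := H (u + v).
move=> _ [mu muV <-]; rewrite linearD.
apply: le_trans (_ : (`|mu u| + `|mu v|) / `|mu| <= _).
  by rewrite ler_wpM2r ?invr_ge0// ler_normD.
rewrite mulrDl; apply: lerD.
  by apply: (sup_upper_bound (H u)); exists mu.
by apply: (sup_upper_bound (H v)); exists mu.
Qed.

Let seminormVZ_le k u : seminormV V (k *: u) <= `|k| * seminormV V u.
Proof.
have [H|H] := seminormV_case; first by rewrite !H mulr0.
apply: ge_sup; first by have [] := H (k *: u).
move=> _ [mu muV <-]; rewrite linearZ normrM -mulrA ler_wpM2l//.
by apply: (sup_upper_bound (H u)); exists mu.
Qed.

Lemma seminormVZ k u : seminormV V (k *: u) = `|k| * seminormV V u.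
Proof.
apply/eqP; rewrite eq_le seminormVZ_le /=.
have [->|k0] := eqVneq k 0; first by rewrite normr0 mul0r seminormV_ge0.
rewrite mulrC -ler_pdivlMr ?normr_gt0// -normfV mulrC.
by rewrite -[X in seminormV _ X <= _](scalerK k0) seminormVZ_le.
Qed.

End SeminormV.

(** * Norms on finite dimensional spaces *)

Section FiniteDimension.
Import VectorInternalTheory.
Variables (R : realType).

Lemma vect_coordinates (X : vectType R) : exists n (r : {linear 'rV[R]_n -> X}) (s : X -> 'rV[R]_n),
  cancel r s /\ cancel s r.
Proof.
exists (dim X), (@r2v R X : {linear 'rV[R]_(dim X) -> X}),
  (@v2r _ X).
by split; [exact: r2vK|exact: v2rK].
Qed.

Lemma rV_coord_le n (x : 'rV[R]_n) i : `|x ord0 i| <= `|x|.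
Proof.
rewrite [leRHS]/Num.norm /= mx_normrE; apply/bigmax_geP; right => /=.
by exists (ord0, i).
Qed.

Lemma linear_rVE n (X : lmodType R) (r : {linear 'rV[R]_n -> X}) x :
  r x = \sum_i x ord0 i *: r (delta_mx ord0 i).
Proof.
rewrite {1}[x]row_sum_delta linear_sum; apply: eq_bigr => i _.
by rewrite linearZ.
Qed.

Lemma linear_rV_bounded n (E : normedModType R) (r : {linear 'rV[R]_n -> E}) :
  exists2 K, 0 <= K & forall x, `|r x| <= K * `|x|.
Proof.
exists (\sum_i `|r (delta_mx ord0 i)|); first exact: sumr_ge0.
move=> x; rewrite linear_rVE mulr_suml.
apply: le_trans (ler_norm_sum _ _ _) _; apply: ler_sum => i _.
by rewrite normrZ mulrC ler_wpM2l// rV_coord_le.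
Qed.

Lemma linear_rV_continuous n (E : normedModType R) (r : {linear 'rV[R]_n -> E}) :
  continuous r.
Proof.
have [K K0 HK] := linear_rV_bounded r.
apply/linear_bounded_continuous/bounded_funP => d.
exists (K * d) => x xd; apply: le_trans (HK x) _.
by rewrite ler_wpM2l.
Qed.

(** N \o r is continuous, and positive on the compact unit sphere, hence bounded
    below there. *)
Lemma is_norm_rV_equiv n (X : lmodType R) (N : X -> R) (r : {linear 'rV[R]_n -> X}) :
  is_norm N -> injective r -> exists2 c, 0 < c & forall x, `|x| <= c * N (r x).
Proof.
move=> [N0 ND NZ Neq0] rI.
have NN x : N (- x) = N x by rewrite -scaleN1r NZ normrN1 mul1r.
pose K := \sum_i N (r (delta_mx ord0 i)).
have Nle x : N (r x) <= K * `|x|.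
  rewrite linear_rVE mulr_suml.
  have Nsum (I : finType) (g : I -> X) : N (\sum_i g i) <= \sum_i N (g i).
    elim/big_ind2 : _ => // [|a b c d ab cd].
      by rewrite -(scale0r 0) NZ normr0 mul0r.
    by apply: le_trans (ND _ _) _; rewrite lerD.
  apply: le_trans (Nsum _ _) _; apply: ler_sum => i _.
  by rewrite NZ mulrC ler_wpM2l// rV_coord_le.
have Nc : continuous (fun x : 'rV[R]_n => N (r x)).
  move=> x; apply/(@cvgrPdist_le _ _ _ (nbhs x)) => e e0.
  have K0 : 0 <= K by apply: sumr_ge0.
  have K1 : 0 < K + 1 by rewrite ltr_wpDl.
  near=> y.
  have H : K * `|x - y| <= e.
    apply: le_trans (_ : (K + 1) * `|x - y| <= _); first by rewrite ler_wpM2r// lerDl.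
    rewrite mulrC -ler_pdivlMr//; near: y; apply/nbhs_ballP.
    exists (e / (K + 1)) => /=; first by rewrite divr_gt0.
    by move=> y; rewrite -ball_normE /= => /ltW.
  apply: le_trans H; apply: le_trans (Nle _); rewrite linearB ler_norml.
  have := ND (r x - r y) (r y); have := ND (r y - r x) (r x).
  rewrite !subrK -(opprB (r x)) NN; lra.
pose S := [set x : 'rV[R]_n | `|x| = 1].
have Sc : compact S.
  apply: bounded_closed_compact.
    by exists 1; rewrite num_real; split => // d d1 x /= ->; exact: ltW.
  apply: (@closed_comp _ _ (fun x : 'rV[R]_n => `|x|) [set 1 : R]).
    by move=> x _; exact: norm_continuous.
  exact: closed_eq.
have normS x : x != 0 -> S (`|x|^-1 *: x).
  by move=> x0; rewrite /S /= normrZ normfV normr_id mulVf// normr_eq0.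
have [S0|S0] := pselect (S !=set0); last first.
  exists 1 => // x; have [->|x0] := eqVneq x 0; first by rewrite normr0 mul1r.
  by exfalso; apply: S0; eexists; exact: normS x0.
have [c /= cS cmin] := compact_EVT_min S0 Sc (continuous_subspaceT Nc).
have Nrc : 0 < N (r c).
  rewrite lt_neqAle N0 andbT eq_sym; apply/eqP => /Neq0 rc.
  move: cS; rewrite inE /S /= (_ : c = 0) ?normr0; first by move/esym/eqP; rewrite oner_eq0.
  by apply: rI; rewrite rc linear0.
exists (N (r c))^-1 => [|x]; first by rewrite invr_gt0.
have [->|x0] := eqVneq x 0; first by rewrite normr0 mulr_ge0// invr_ge0 ltW.
rewrite mulrC ler_pdivlMr//.
have := cmin _ (mem_set (normS _ x0)).
by rewrite linearZ NZ normfV normr_id mulrC ler_pdivlMr ?normr_gt0// mulrC.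
Unshelve. all: by end_near. Qed.

Lemma is_norm_linear_bounded (X : vectType R) (N : X -> R) (E : normedModType R)
    (g : {linear X -> E}) : is_norm N ->
  exists2 K, 0 <= K & forall x, `|g x| <= K * N x.
Proof.
move=> NN; have [n [r [s [rK sK]]]] := vect_coordinates X.
have [c c0 Hc] := is_norm_rV_equiv NN (can_inj rK).
have [K K0 HK] := linear_rV_bounded (g \o r : {linear _ -> _}).
exists (K * c) => [|x]; first by rewrite mulr_ge0// ltW.
have := HK (s x); rewrite /= sK => /le_trans; apply.
by rewrite -mulrA ler_wpM2l//; have := Hc (s x); rewrite sK.
Qed.

End FiniteDimension.

(** * Real powers *)

Section Powers.
Variables (R : realType) (p : R).
Hypothesis hp : 1 < p.

Let p0 : 0 < p. Proof. exact: lt_trans hp. Qed.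

Lemma pnorm_powR (x y : R) : ((x `^ p + y `^ p) `^ p^-1) `^ p = x `^ p + y `^ p.
Proof.
by rewrite -powRrM mulVf ?gt_eqF// powRr1// addr_ge0// powR_ge0.
Qed.

Let powRK (x : R) : 0 <= x -> (x `^ p) `^ p^-1 = x.
Proof. by move=> x0; rewrite -powRrM mulfV ?gt_eqF// powRr1. Qed.

Let pV_ge0 : 0 <= p^-1. Proof. by rewrite invr_ge0 ltW. Qed.

Lemma pnorm_ge_l (x y : R) : 0 <= x -> x <= (x `^ p + y `^ p) `^ p^-1.
Proof.
move=> x0; rewrite -{1}(powRK x0); apply: ge0_ler_powR => //;
  rewrite ?nnegrE ?addr_ge0 ?powR_ge0//.
by rewrite lerDl powR_ge0.
Qed.

Lemma pnorm_ge_r (x y : R) : 0 <= y -> y <= (x `^ p + y `^ p) `^ p^-1.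
Proof. by rewrite addrC; exact: pnorm_ge_l. Qed.

Lemma pnorm_le (x y : R) : 0 <= x -> 0 <= y ->
  (x `^ p + y `^ p) `^ p^-1 <= 2 * (x + y).
Proof.
move=> x0 y0; have xy0 : 0 <= 2 * (x + y) by rewrite mulr_ge0// addr_ge0.
rewrite -[leRHS](powRK xy0); apply: ge0_ler_powR => //;
  rewrite ?nnegrE ?addr_ge0 ?powR_ge0//.
apply: le_trans (_ : (x + y) `^ p + (x + y) `^ p <= _).
  by apply: lerD; apply: ge0_ler_powR; rewrite ?nnegrE ?addr_ge0 ?(ltW p0)//
    ?lerDl ?lerDr.
rewrite powRM ?addr_ge0//.
have : (x + y) `^ p * 2 <= (x + y) `^ p * 2 `^ p.
  by rewrite ler_wpM2l ?powR_ge0// -[leLHS]powRr1// ler_powR ?ler1n// ltW.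
lra.
Qed.

(** As p > 1, the power p of N outgrows any linear function of N.
    Both the a priori estimate and the outward direction of the scheme's field
    rest on this. *)
Lemma superlinear_bound (al M : R) : 0 < al -> 0 <= M ->
  exists2 N0, 0 < N0 & forall N, 0 <= N -> al * N `^ p <= M * N -> N < N0.
Proof.
move=> al0 M0; have p10 : 0 < p - 1 by rewrite subr_gt0.
have p1n : p - 1 != 0 by rewrite gt_eqF.
have Ma : 0 < M / al + 1 by rewrite ltr_wpDl// divr_ge0// ltW.
exists ((M / al + 1) `^ (p - 1)^-1) => [|N N_ge0]; first exact: powR_gt0.
apply: contraTT; rewrite -leNgt -ltNge => HN.
have N_gt0 : 0 < N by apply: lt_le_trans HN; exact: powR_gt0.
have : M / al + 1 <= N `^ (p - 1).
  set B := M / al + 1 in Ma HN *.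
  have -> : B = (B `^ (p - 1)^-1) `^ (p - 1).
    by rewrite -powRrM mulVf// powRr1// ltW.
  by apply: ge0_ler_powR => //; rewrite ?nnegrE ?powR_ge0 ?(ltW p10).
rewrite -(ler_pM2l al0) mulrDr mulrCA divff ?gt_eqF// !mulr1 => H.
have -> : N `^ p = N `^ (p - 1) * N.
  by rewrite -[X in _ * X](powRr1 N_ge0) -powRD ?subrK ?gt_eqF//.
rewrite mulrA ltr_pM2r//; apply: lt_le_trans H; by rewrite ltrDl.
Qed.

End Powers.

(** * Existence of a solution to the gradient scheme *)

Section Discretisation.
Variables (R : realType) (p : R) (hp : 1 < p) (L bL : normedModType R).
Variables (V : submodClosed (dual L)) (D : grad_disc p bL V).
Implicit Types u v : gd_space D.

Lemma gd_norm_is_norm : is_norm (@gd_norm _ _ _ _ _ D).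
Proof. exact: gd_is_norm. Qed.

Lemma gd_norm_ge0 u : 0 <= gd_norm u. Proof. by have [] := gd_norm_is_norm. Qed.

Lemma gd_norm_gt0 u : u != 0 -> 0 < gd_norm u.
Proof.
have [_ _ _ N0] := gd_norm_is_norm.
move=> u0; rewrite lt_neqAle gd_norm_ge0 andbT eq_sym.
by apply: contra u0 => /eqP/N0 ->.
Qed.

Lemma gd_norm_pow u : gd_norm u `^ p = seminormV V (gd_P D u) `^ p + `|gd_G D u| `^ p.
Proof. exact: pnorm_powR. Qed.

Lemma gd_G_le u : `|gd_G D u| <= gd_norm u.
Proof. exact: pnorm_ge_r. Qed.

Lemma gd_P_seminorm_le u : seminormV V (gd_P D u) <= gd_norm u.
Proof. by apply: pnorm_ge_l => //; exact: seminormV_ge0. Qed.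

Variables (ba : L -> bL -> dual bL) (a : L -> dual L).
Variables (f : dual L) (bF : dual bL) (alphaU alphaL : R).
Hypothesis (alphaU_ge0 : 0 <= alphaU).
Hypothesis (A3 : assumption_A3 p ba alphaL) (A6 : assumption_A6 p V a alphaL).

(** The right-hand side is the residual of the scheme at u tested with u. *)
Lemma gd_energy u (K : R) : `|gd_P D u| <= K * gd_norm u ->
  alphaL * gd_norm u `^ p - (`|f| * K + `|bF|) * gd_norm u <=
  ba (gd_P D u) (gd_G D u) (gd_G D u) + a (gd_P D u) (gd_P D u)
  - f (gd_P D u) + bF (gd_G D u).
Proof.
move=> HK; rewrite gd_norm_pow mulrDr.
have := A3 (gd_P D u) (gd_G D u); have := A6 (gd_P D u).
have : f (gd_P D u) <= `|f| * K * gd_norm u.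
  apply: le_trans (ler_norm _) _; apply: le_trans (dual_norm_bound _ _) _.
  by rewrite -mulrA ler_wpM2l.
have : - bF (gd_G D u) <= `|bF| * gd_norm u.
  apply: le_trans (ler_norm _) _; rewrite normrN.
  apply: le_trans (dual_norm_bound _ _) _.
  by rewrite ler_wpM2l// gd_G_le.
lra.
Qed.

(** In coordinates the scheme is the vanishing of finitely many residuals; the
    field they form points outwards on a large cube by [gd_energy] and
    [superlinear_bound]. *)
Lemma GS_solution_exists (alphaL_gt0 : 0 < alphaL)
    (A1 : assumption_A1 p ba alphaU) (A2 : assumption_A2 ba)
    (A4 : assumption_A4 p a alphaU) :
  exists u : gd_space D, GS_solution ba a f bF u.
Proof.
have [n [r [s [rK sK]]]] := vect_coordinates (gd_space D).
have [c c0 Hc] := is_norm_rV_equiv gd_norm_is_norm (can_inj rK).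
have [K K0 HK] := is_norm_linear_bounded (gd_P D) gd_norm_is_norm.
have M0 : 0 <= `|f| * K + `|bF| by rewrite addr_ge0// mulr_ge0.
have [N0 N00 HN0] := superlinear_bound hp alphaL_gt0 M0.
pose res u v : R := ba (gd_P D u) (gd_G D u) (gd_G D v) + a (gd_P D u) (gd_P D v)
  - f (gd_P D v) + bF (gd_G D v).
have resl u v : res u v = \sum_i res u (r (delta_mx ord0 i)) * s v ord0 i.
  have lin : linear (fun x => res u (r x) : R^o).
    move=> k x y.
    have lc (X : normedModType R) (mu : dual X) (g : {linear gd_space D -> X}) :
      mu (g (r (k *: x + y))) = k * mu (g (r x)) + mu (g (r y)) by rewrite !linearP.
    by rewrite /res !lc -[k *: (_ : R^o)]/(k * _); ring.
  pose rl : {linear 'rV[R]_n -> R^o} :=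
    HB.pack (fun x => res u (r x) : R^o) (GRing.isLinear.Build R _ R^o _ _ lin).
  rewrite -{1}[v]sK -[LHS]/(rl (s v)) linear_rVE; apply: eq_bigr => i _.
  by rewrite mulrC.
have [|||x Hx] := @zero_of_outward_field R n (c * N0)
    (fun i x => res (r x) (r (delta_mx ord0 i))).
- by rewrite mulr_gt0.
- move=> i x.
  have Pc : {for x, continuous (gd_P D \o r)}.
    exact: (@linear_rV_continuous R n L (gd_P D \o r : {linear _ -> _})).
  have Gc : {for x, continuous (gd_G D \o r)}.
    exact: (@linear_rV_continuous R n bL (gd_G D \o r : {linear _ -> _})).
  have [A4c _] := A4.
  have bac : (fun x => ba (gd_P D (r x)) (gd_G D (r x)) (gd_G D (r (delta_mx ord0 i))) : R)
      @ x --> (ba (gd_P D (r x)) (gd_G D (r x)) (gd_G D (r (delta_mx ord0 i))) : R).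
    exact: (demicontinuous hp alphaU_ge0 A1 A2 _ Pc Gc).
  have ac : (fun x => a (gd_P D (r x)) (gd_P D (r (delta_mx ord0 i))) : R)
      @ x --> (a (gd_P D (r x)) (gd_P D (r (delta_mx ord0 i))) : R).
    exact: (cvg_comp _ _ Pc (@weak_star_continuous_apply _ _ _ _ A4c _ _)).
  exact: (cvgD (cvgB (cvgD bac ac) (cvg_cst _)) (cvg_cst _)).
- move=> x [i xi].
  have := resl (r x) (r x); rewrite rK => <-.
  apply: lt_le_trans (gd_energy (HK (r x))).
  rewrite subr_gt0 ltNge; apply/negP => /(HN0 _ (gd_norm_ge0 _)).
  apply/negP; rewrite -leNgt -(ler_pM2l c0) -xi.
  by apply: le_trans (Hc x); exact: rV_coord_le.
exists (r x) => v; apply/eqP; rewrite -subr_eq0; apply/eqP.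
transitivity (res (r x) v); first by rewrite /res; ring.
by rewrite resl big1 // => i _; rewrite Hx mul0r.
Qed.

Lemma GS_solution_bound (K : R) :
  (forall u, `|gd_P D u| <= K * gd_norm u) ->
  forall u, GS_solution ba a f bF u ->
  alphaL * gd_norm u `^ p <= (`|f| * K + `|bF|) * gd_norm u.
Proof.
move=> HK u Hu; rewrite -subr_le0; apply: le_trans (gd_energy (HK u)) _.
by rewrite Hu; lra.
Qed.

End Discretisation.

(** * Uniform coercivity of limit-conforming discretisations *)

Section Coercivity.
Variables (R : realType) (p : R) (hp : 1 < p) (L bL : normedModType R).

Lemma dual_eq0_dense (E : normedModType R) (S : set E) (mu : dual E) : dense S ->
  (forall x, S x -> mu x = 0) -> mu = 0.
Proof.
move=> dS muS; apply: dual_ext => x; rewrite dual0E; apply/eqP.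
rewrite -normr_le0; apply/ler_addgt0Pr => e e0; rewrite add0r.
have m1 : 0 < `|mu| + 1 by rewrite ltr_wpDl.
have [z [xz Sz]] : (ball x (e / (`|mu| + 1)) `&` S) !=set0.
  by apply: dS; [exists x; apply: ballxx; rewrite divr_gt0|exact: ball_open].
move: xz; rewrite -ball_normE /ball_ /= ltr_pdivlMr// => xz.
rewrite -[mu x]subr0 -(muS z Sz) -linearB; apply: le_trans (dual_norm_bound _ _) _.
by apply: le_trans (ltW xz); rewrite mulrC ler_wpM2l// lerDl.
Qed.

Variables (WG : submodClosed L) (WG_dense : dense [set x : L | x \in WG]).
Variables (G : {linear submod_of WG -> bL}) (V : submodClosed (dual L)).

Lemma DopE (phi : dual bL) (w : dual L) : is_D_of G phi w -> Dop G phi = w.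
Proof.
move=> Hw; have HD : is_D_of G phi (Dop G phi) by apply: (@xgetPex _ 0 [set w | is_D_of G phi w]); exists w.
apply/eqP; rewrite -subr_eq0; apply/eqP; apply: (dual_eq0_dense WG_dense) => x xW.
rewrite dualBE; have := HD (exist _ x xW); have := Hw (exist _ x xW) => /=.
by lra.
Qed.

Variables (C : R) (C_gt0 : 0 < C).
Hypothesis norm_equiv :
  forall u : submod_of WG, normWG_graph p G u <= C * normWG p G V u.

(** On L * bL the sublinear function q (x, y) = K (|x|_V + |y|) dominates g on the
    graph of G, by the equivalence of norms on WG. The components of a
    Hahn-Banach extension of g from the graph are lam and phi. *)
Lemma dual_decomposition (g : dual L) :
  exists (lam : dual L) (phi : dual bL) (K : R),
  [/\ 0 <= K, forall x, `|lam x| <= K * seminormV V x & is_D_of G phi (lam - g)].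
Proof.
pose K := `|g| * (C * 2).
have K0 : 0 <= K by rewrite !mulr_ge0// ltW.
pose q (z : L * bL) := K * (seminormV V z.1 + `|z.2|).
have qD x y : q (x + y) <= q x + q y.
  rewrite /q -mulrDr ler_wpM2l//.
  have := seminormVD V x.1 y.1; have := ler_normD x.2 y.2 => /=; lra.
have qZ k x : 0 <= k -> q (k *: x) = k * q x.
  by move=> k0; rewrite /q /= seminormVZ normrZ ger0_norm//; ring.
have gb (u : submod_of WG) : `|g (val u)| <= K * (seminormV V (val u) + `|G u|).
  apply: le_trans (dual_norm_bound _ _) _; rewrite -mulrA ler_wpM2l//.
  apply: le_trans (pnorm_ge_l hp (`|G u|) (normr_ge0 _)) _.
  apply: le_trans (norm_equiv u) _; rewrite -mulrA ler_wpM2l ?(ltW C_gt0)//.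
  by apply: pnorm_le => //; exact: seminormV_ge0.
have [||F [FB Fq]] := hahn_banach qD qZ
  (B0 := [set z | exists u : submod_of WG, z = ((val u, G u), g (val u))]).
- by exists 0; rewrite !linear0.
- split=> [k _ _ [u ->] [v ->]|_ [u ->]] /=.
    by exists (k *: u + v); rewrite !linearP.
  by apply: le_trans (gb u); exact: ler_norm.
have Fabs z : `|F z| <= q z.
  rewrite ler_norml Fq andbT lerNl -linearN; apply: le_trans (Fq _) _.
  by rewrite /q /= -scaleN1r seminormVZ normrN normr1 mul1r normrN.
have Fl1 : linear (fun x : L => F (x, 0)).
  by move=> k x y; rewrite -linearP; congr (F (_, _)); rewrite /= scaler0 addr0.
have Fl2 : linear (fun y : bL => F (0, y)).
  by move=> k x y; rewrite -linearP; congr (F (_, _)); rewrite /= scaler0 addr0.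
pose F1 : {linear L -> R^o} :=
  HB.pack (fun x : L => F (x, 0)) (GRing.isLinear.Build R L R^o _ _ Fl1).
pose F2 : {linear bL -> R^o} :=
  HB.pack (fun y : bL => F (0, y)) (GRing.isLinear.Build R bL R^o _ _ Fl2).
have F1b x : `|F1 x| <= K * seminormV V x.
  by have := Fabs (x, 0); rewrite /q /= normr0 addr0.
have F2b y : `|F2 y| <= K * `|y|.
  by have := Fabs (0, y); rewrite /q /= -(scale0r 0) seminormVZ normr0 mul0r add0r.
have [lam lamE] : exists lam : dual L, forall x, lam x = F1 x.
  apply: (@dual_of_bounded _ _ F1 K) => x; apply: le_trans (F1b x) _.
  by rewrite ler_wpM2l// seminormV_le.
have [phi phiE] := dual_of_bounded F2b.
exists lam, phi, K; split=> [//|x|u]; first by rewrite lamE.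
rewrite dualBE lamE phiE /= addrA -linearD /=.
have -> : (0, G u) + (val u, 0) = (val u, G u) by congr (_, _); rewrite /= ?add0r ?addr0.
by rewrite (FB ((val u, G u), g (val u))) ?subrr//; exists u.
Qed.

Lemma W_D_bound (D : grad_disc p bL V) (phi : dual bL) (u : gd_space D) :
  `|phi (gd_G D u) + Dop G phi (gd_P D u)| <= W_D G D phi * gd_norm u.
Proof.
have [_ _ NZ _] := gd_norm_is_norm D.
have [->|u0] := eqVneq u 0.
  rewrite !linear0 addr0 normr0 -[X in gd_norm X](scale0r 0).
  by rewrite NZ normr0 mul0r mulr0.
have Nu := gd_norm_gt0 u0.
rewrite -ler_pdivrMr//; apply: sup_upper_bound; last by exists u.
split; first by eexists; exists u.
have [K K0 HK] := is_norm_linear_bounded (gd_P D) (gd_norm_is_norm D).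
exists (`|phi| + `|Dop G phi| * K) => _ [v /= v0 <-].
have Nv := gd_norm_gt0 v0.
rewrite ler_pdivrMr// mulrDl; apply: le_trans (ler_normD _ _) _; apply: lerD.
  apply: (le_trans (dual_norm_bound phi (gd_G D v))).
  exact: (ler_wpM2l (normr_ge0 phi) (gd_G_le hp v)).
by apply: le_trans (dual_norm_bound _ _) _; rewrite -mulrA ler_wpM2l.
Qed.

(** For a functional g, [dual_decomposition] writes g (P u) as
    lam (P u) + phi (G u) minus the conformity defect of phi at u, and each term
    is at most a constant times the discrete norm of u. Uniform boundedness
    concludes. *)
Lemma limit_conforming_coercive (D : nat -> grad_disc p bL V) :
  limit_conforming G D ->
  exists2 K, 0 <= K & forall m (u : gd_space (D m)), `|gd_P (D m) u| <= K * gd_norm u.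
Proof.
move=> Dlc.
pose x (i : {m : nat & gd_space (D m)}) : L :=
  (gd_norm (projT2 i))^-1 *: gd_P (D (projT1 i)) (projT2 i).
have [|M HM] := @weakly_bounded_bounded R L _ x.
  move=> g; have [lam [phi [K [K0 Hlam HD]]]] := dual_decomposition g.
  have phiWD : WD G phi by exists (lam - g).
  have [W0 HW] : exists W0, forall m, `|W_D G (D m) phi| <= W0.
    have /cvgP/cvg_seq_bounded[W0 [_ HW]] := Dlc _ phiWD.
    by exists (W0 + 1) => m; apply: HW => //; rewrite ltrDl.
  exists (K + `|phi| + W0) => -[m u]; rewrite /x /=.
  have [->|u0] := eqVneq u 0.
    rewrite linear0 scaler0 linear0 normr0 !addr_ge0//.
    exact: le_trans (normr_ge0 _) (HW 0%N).
  have Nu := gd_norm_gt0 u0.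
  rewrite linearZ normrZ normfV gtr0_norm// mulrC ler_pdivrMr//.
  have H1 : `|phi (gd_G (D m) u) + (lam - g) (gd_P (D m) u)| <= W0 * gd_norm u.
    have := W_D_bound phi u; rewrite (DopE HD) => /le_trans; apply.
    by rewrite ler_wpM2r ?(ltW Nu)//; apply: le_trans (HW m); exact: ler_norm.
  have H2 : `|lam (gd_P (D m) u)| <= K * gd_norm u.
    by apply: le_trans (Hlam _) _; rewrite ler_wpM2l// gd_P_seminorm_le.
  have H3 : `|phi (gd_G (D m) u)| <= `|phi| * gd_norm u.
    by apply: le_trans (dual_norm_bound _ _) _; rewrite ler_wpM2l// gd_G_le.
  move: H1 H2 H3; rewrite dualBE !ler_norml; lra.
exists `|M| => // m u; have [->|u0] := eqVneq u 0.
  by rewrite linear0 normr0 mulr_ge0// gd_norm_ge0.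
have Nu := gd_norm_gt0 u0.
have := HM (existT _ m u); rewrite /x /= normrZ normfV gtr0_norm//.
rewrite mulrC ler_pdivrMr// => /le_trans; apply.
by rewrite ler_wpM2r ?(ltW Nu)// ler_norm.
Qed.

End Coercivity.

(** * Convergence of the gradient schemes *)

(** A point off the closed graph would be separated from it by a functional on
    L * bL, whose components w and phi satisfy [is_D_of phi w] because it vanishes
    on the graph. *)
Lemma closed_graph_annihilator (R : realType) (L bL : normedModType R)
    (WG : submodClosed L) (G : {linear submod_of WG -> bL}) y z :
  closed_graph G ->
  (forall (phi : dual bL) (w : dual L), is_D_of G phi w -> phi z + w y = 0) ->
  exists2 u : submod_of WG, val u = y & G u = z.
Proof.
move=> Gc H; apply: contrapT => nG.
have [|||mu mu0 muyz] := @dual_separates_closed R (L * bL)%type _ (y, z) Gc.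
- by exists 0; rewrite !linear0.
- by move=> k _ _ [u ->] [v ->]; exists (k *: u + v); rewrite !linearP.
- by move=> [u [yu zu]]; apply: nG; exists u.
have l1 : linear (fun x : L => mu (x, 0) : R^o).
  by move=> k x x'; rewrite -linearP; congr (mu (_, _)); rewrite /= scaler0 addr0.
have l2 : linear (fun x : bL => mu (0, x) : R^o).
  by move=> k x x'; rewrite -linearP; congr (mu (_, _)); rewrite /= scaler0 addr0.
have b1 x : `|mu (x, 0)| <= `|mu| * `|x|.
  apply: le_trans (dual_norm_bound _ _) _; rewrite ler_wpM2l//.
  by rewrite prod_normE /= normr0 ge_max lexx normr_ge0.
have b2 x : `|mu (0, x)| <= `|mu| * `|x|.
  apply: le_trans (dual_norm_bound _ _) _; rewrite ler_wpM2l//.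
  by rewrite prod_normE /= normr0 ge_max lexx normr_ge0.
pose F1 : {linear L -> R^o} :=
  HB.pack (fun x : L => mu (x, 0) : R^o) (GRing.isLinear.Build R L R^o _ _ l1).
pose F2 : {linear bL -> R^o} :=
  HB.pack (fun x : bL => mu (0, x) : R^o) (GRing.isLinear.Build R bL R^o _ _ l2).
have [w wE] := @dual_of_bounded R L F1 _ b1.
have [phi phiE] := @dual_of_bounded R bL F2 _ b2.
have pairE x x' : phi x' + w x = mu (x, x').
  by rewrite phiE wE /= -linearD; congr (mu (_, _)); rewrite /= ?add0r ?addr0.
move/eqP: muyz; apply; rewrite -pairE; apply: H => u.
by rewrite pairE; apply: mu0; exists u.
Qed.

(** S_D is an infimum; an element that attains it up to 1 / (m + 1) is enough. *)
Lemma consistent_recovery (R : realType) (p : R) (L bL : normedModType R)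
    (WG : submodClosed L) (G : {linear submod_of WG -> bL})
    (V : submodClosed (dual L)) (D : nat -> grad_disc p bL V) (phi : submod_of WG) :
  consistent G D ->
  exists v : forall m, gd_space (D m),
    (fun m => gd_P (D m) (v m)) @ \oo --> val phi /\
    (fun m => gd_G (D m) (v m)) @ \oo --> G phi.
Proof.
move=> /(_ phi) Dc.
pose err m v := `|gd_P (D m) v - val phi| + `|gd_G (D m) v - G phi|.
have Hex m : exists v, err m v < S_D G (D m) phi + m.+1%:R^-1.
  have lt : S_D G (D m) phi < S_D G (D m) phi + m.+1%:R^-1.
    by rewrite ltrDl invr_gt0 ltr0n.
  have [|_ [v _ <-] ve] := inf_lt _ lt; last by exists v.
  by exists (err m 0), 0.
pose v m := sval (cid (Hex m)).
have Hv m : err m (v m) < S_D G (D m) phi + m.+1%:R^-1 by exact: svalP (cid (Hex m)).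
have err0 : (fun m => S_D G (D m) phi + m.+1%:R^-1) @ \oo --> (0 : R).
  by rewrite -[X in _ --> X]addr0; apply: cvgD => //; exact: cvg_harmonic.
exists v; split; apply/subr_cvg0/norm_cvg0P;
  apply: (squeeze_cvgr _ (cvg_cst 0) err0); apply: nearW => m;
  rewrite normr_ge0 /=; apply: le_trans (ltW (Hv m)); rewrite /err.
  by rewrite lerDl.
by rewrite lerDr.
Qed.

(** The k-th index is chosen so that the first k + 1 quantities are within
    1 / (k + 1) of their limits. *)
Lemma ultra_countable_subsequence (R : realType) (J : countType)
    (U : set_system nat) (g : J -> nat -> R) (l : J -> R) :
  UltraFilter U -> \oo `<=` U -> (forall j, g j @ U --> l j) ->
  exists2 sigma : nat -> nat, {homo sigma : m n / (m < n)%N} &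
    forall j, (fun k => g j (sigma k)) @ \oo --> l j.
Proof.
move=> UU ooU gl.
pose A k := [set m | forall n : 'I_k.+1,
  if unpickle n is Some j then `|l j - g j m| < k.+1%:R^-1 else true].
have UA k : U (A k).
  apply: filter_forall => n; case: unpickle => [j|]; last exact: filterE.
  have /cvgrPdist_lt := gl j; apply; by rewrite invr_gt0 ltr0n.
have [sigma sh sA] := ultra_subsequence UU ooU UA; exists sigma => // j.
apply/cvgrPdist_lt => e e0; near=> k.
have jk : (pickle j < k.+1)%N.
  by rewrite ltnS ltnW//; near: k; exact: nbhs_infty_gt.
have := sA k (Ordinal jk); rewrite /= pickleK => /lt_trans; apply.
rewrite -[ltRHS]invrK ltf_pV2 ?posrE ?ltr0n ?invr_gt0//.
apply: (@lt_trans _ _ k%:R); last by rewrite ltr_nat.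
by near: k; exact: nbhs_infty_gtr.
Unshelve. all: by end_near. Qed.

Section Convergence.
Variables (R : realType) (p : R) (hp : 1 < p).
Variables (L bL : completeNormedModType R).
Variables (L_reflexive : reflexive_space L) (bL_reflexive : reflexive_space bL).
Variables (WG : submodClosed L) (WG_dense : dense [set x : L | x \in WG]).
Variables (G : {linear submod_of WG -> bL}) (G_closed : closed_graph G).
Variables (V : submodClosed (dual L)) (C : R) (C_gt0 : 0 < C).
Hypothesis norm_equiv :
  forall u : submod_of WG, normWG_graph p G u <= C * normWG p G V u.
Variables (alphaU alphaL : R) (alphaU_ge0 : 0 <= alphaU) (alphaL_gt0 : 0 < alphaL).
Variables (ba : L -> bL -> dual bL) (a : L -> dual L).
Hypotheses (A1 : assumption_A1 p ba alphaU) (A2 : assumption_A2 ba)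
  (A3 : assumption_A3 p ba alphaL) (A4 : assumption_A4 p a alphaU)
  (A5 : assumption_A5 a) (A6 : assumption_A6 p V a alphaL).
Variables (f : dual L) (bF : dual bL) (D : nat -> grad_disc p bL V).
Hypotheses (D_consistent : consistent G D) (D_limit_conforming : limit_conforming G D).
Variable u : forall m : nat, gd_space (D m).
Hypothesis u_sol : forall m, GS_solution ba a f bF (u m).

(** The scheme tested with its own solution, together with uniform
    coercivity. *)
Lemma GS_solutions_bounded : exists2 M, 0 < M &
  forall m, [/\ gd_norm (u m) <= M, `|gd_P (D m) (u m)| <= M & `|gd_G (D m) (u m)| <= M].
Proof.
have [K K0 HK] := limit_conforming_coercive hp WG_dense C_gt0 norm_equiv D_limit_conforming.
have M0 : 0 <= `|f| * K + `|bF| by rewrite addr_ge0// mulr_ge0.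
have [N0 N00 HN0] := superlinear_bound hp alphaL_gt0 M0.
have uN m : gd_norm (u m) <= N0.
  apply/ltW/HN0; first exact: gd_norm_ge0.
  exact: (GS_solution_bound hp A3 A6 (HK m)).
exists (Num.max N0 (K * N0)) => [|m]; first by rewrite lt_max N00.
split; rewrite le_max ?uN//.
  by rewrite orbC (le_trans (HK m _))// ler_wpM2l.
by rewrite (le_trans (gd_G_le hp _)).
Qed.

(** The limit argument. The hypothesis on ba holds in the two cases of interest
    for different reasons; everything else is common to them. *)
Lemma ultra_limit_solution (U : set_system nat) : UltraFilter U -> \oo `<=` U ->
  (forall y, (forall mu : dual L, (fun m => mu (gd_P (D m) (u m)) : R) @ U --> (mu y : R)) ->
    forall ww, (fun m => ba (gd_P (D m) (u m)) ww) @ U --> ba y ww) ->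
  exists ubar : submod_of WG, [/\ P_solution G ba a f bF ubar,
    forall mu : dual L, (fun m => mu (gd_P (D m) (u m)) : R) @ U --> (mu (val ubar) : R) &
    forall mu : dual bL, (fun m => mu (gd_G (D m) (u m)) : R) @ U --> (mu (G ubar) : R)].
Proof.
move=> UU ooU baU.
have [M M0 uM] := GS_solutions_bounded.
pose Pu m := gd_P (D m) (u m); pose Gu m := gd_G (D m) (u m).
have PM : \forall m \near U, `|Pu m| <= M by apply: filterE => m; have [] := uM m.
have GM : \forall m \near U, `|Gu m| <= M by apply: filterE => m; have [] := uM m.
have [y Py] := reflexive_weak_ultra L_reflexive UU PM.
have [z Gz] := reflexive_weak_ultra bL_reflexive UU GM.
have [ubar uy uz] : exists2 ubar : submod_of WG, val ubar = y & G ubar = z.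
  apply: closed_graph_annihilator G_closed _ => phi w phiw.
  have lim1 : (fun m => phi (Gu m) + w (Pu m) : R) @ U --> (phi z + w y : R).
    by apply: cvgD; [exact: Gz|exact: Py].
  have W0 : (fun m => `|W_D G (D m) phi| * M) @ U --> (0 : R).
    rewrite -(mul0r M) -(normr0 R); apply: cvgM; last exact: cvg_cst.
    by apply: cvg_norm; apply: cvg_finer ooU _; apply: D_limit_conforming; exists w.
  apply: (@cvg_unique _ _ ((fun m => phi (Gu m) + w (Pu m) : R) @ U)) => //=.
  apply/norm_cvg0P; apply: (squeeze_cvgr _ (cvg_cst 0) W0); apply: filterE => m.
  rewrite normr_ge0 /= -(DopE WG_dense phiw).
  have [uNM _ _] := uM m.
  apply: le_trans (W_D_bound hp G phi (u m)) _.
  apply: le_trans (ler_norm _) _; rewrite normrM (ger0_norm (gd_norm_ge0 _)).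
  by rewrite ler_wpM2l.
have [Kb HKb] := growth_bounded hp alphaU_ge0 A1 M.
pose Am m := ba (Pu m) (Gu m); pose am m := a (Pu m).
have AmK : \forall m \near U, `|Am m| <= Kb.
  by apply: filterE => m; have [_ ? ?] := uM m; exact: HKb.
have amK : \forall m \near U, `|am m| <= alphaU * (1 + M `^ (p - 1)).
  apply: filterE => m; have [_ PuM _] := uM m; have [_ H] := A4.
  apply: le_trans (H _) _; rewrite ler_wpM2l// lerD2l.
  by apply: ge0_ler_powR; rewrite ?nnegrE ?subr_ge0 ?(ltW hp) ?(ltW M0).
have [chi Hchi] := dual_weak_star_ultra UU AmK.
have [chi0 Hchi0] := dual_weak_star_ultra UU amK.
have limit_eq (v : submod_of WG) :
    chi (G v) + chi0 (val v) = f (val v) - bF (G v).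
  have [vm [Pv Gv]] := consistent_recovery v D_consistent.
  have {}Pv := cvg_finer ooU Pv; have {}Gv := cvg_finer ooU Gv.
  apply: (@cvg_unique _ _
    ((fun m => f (gd_P (D m) (vm m)) - bF (gd_G (D m) (vm m)) : R) @ U)) => //=.
    under eq_fun do rewrite -u_sol.
    apply: cvgD; first exact: cvg_pairing_strong AmK Gv (Hchi _).
    exact: cvg_pairing_strong amK Pv (Hchi0 _).
  apply: cvgB; first exact: (cvg_comp _ _ Pv (@dual_continuous _ _ f _)).
  exact: (cvg_comp _ _ Gv (@dual_continuous _ _ bF _)).
have pair_bounded (E : normedModType R) (mu : nat -> dual E) (x : nat -> E) K K' :
    (\forall m \near U, `|mu m| <= K) -> (\forall m \near U, `|x m| <= K') ->
    cvg ((fun m => mu m (x m) : R) @ U).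
  move=> muK xK; apply: (@bounded_ultra_cvg R nat U _ (K * K')).
  apply: filterS2 muK xK => m H1 H2; apply: le_trans (dual_norm_bound _ _) _.
  by rewrite ler_pM.
have /cvg_ex[/= l1 Hl1] := pair_bounded _ _ _ _ _ AmK GM.
have /cvg_ex[/= l2 Hl2] := pair_bounded _ _ _ _ _ amK PM.
(* The energy identity: the scheme tested with u, against the limit equation
   tested with ubar. *)
have l12 : l1 + l2 = chi z + chi0 y.
  rewrite -uy -uz limit_eq uy uz.
  apply: (@cvg_unique _ _ ((fun m => f (Pu m) - bF (Gu m) : R) @ U)) => //=.
    by under eq_fun do rewrite -u_sol; apply: cvgD.
  by apply: cvgB; [exact: Py|exact: Gz].
have monoA t w : 0 <= (Am t - ba (Pu t) w) (Gu t - w) by exact: A2.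
have monoa t w : 0 <= (am t - a w) (Pu t - w) by exact: A5.
have acst w : (fun=> a w) @ U --> a w by exact: cvg_cst.
have le1 : chi z <= l1.
  exact: (minty_liminf (B := fun m => ba (Pu m)) (B' := ba y) monoA (baU y Py) GM Gz Hchi Hl1).
have le2 : chi0 y <= l2.
  exact: (minty_liminf (B := fun=> a) (B' := a) monoa acst PM Py Hchi0 Hl2).
have e1 : l1 = chi z by lra.
have e2 : l2 = chi0 y by lra.
have [_ A1w _] := A1; have [A4c _] := A4.
have chiE : chi = ba y z.
  apply: (minty_eq (B := fun m => ba (Pu m)) (B' := ba y) monoA (baU y Py) GM Gz Hchi Hl1) => //.
  by move=> w; apply: hemicontinuous_segment; exact: A1w.
have chi0E : chi0 = a y.
  apply: (minty_eq (B := fun=> a) (B' := a) monoa acst PM Py Hchi0 Hl2) => //.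
  by move=> w; apply: hemicontinuous_segment; exact: A4c.
exists ubar; split; [|by rewrite uy|by rewrite uz].
by move=> v; rewrite uy uz -chiE -chi0E.
Qed.

Lemma ultra_limit_monotone (U : set_system nat) : UltraFilter U -> \oo `<=` U ->
  depends_only_on_snd ba ->
  exists ubar : submod_of WG, [/\ P_solution G ba a f bF ubar,
    forall mu : dual L, (fun m => mu (gd_P (D m) (u m)) : R) @ U --> (mu (val ubar) : R) &
    forall mu : dual bL, (fun m => mu (gd_G (D m) (u m)) : R) @ U --> (mu (G ubar) : R)].
Proof.
move=> UU ooU ba2; apply: ultra_limit_solution => // y _ ww.
under eq_fun do rewrite (ba2 _ y); exact: cvg_cst.
Qed.

(** Relative compactness gives a strong limit of P u along U; it must agree with
    the weak one, so the norm continuity of ba in its first argument applies. *)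
Lemma ultra_limit_compact (U : set_system nat) : UltraFilter U -> \oo `<=` U ->
  compact_gds D ->
  exists ubar : submod_of WG, [/\ P_solution G ba a f bF ubar,
    (fun m => gd_P (D m) (u m)) @ U --> val ubar &
    forall mu : dual bL, (fun m => mu (gd_G (D m) (u m)) : R) @ U --> (mu (G ubar) : R)].
Proof.
move=> UU ooU Dcompact.
have [M _ uM] := GS_solutions_bounded.
have [||l _ Pl] := @compact_ultra_cvg nat L U
    (closure (range (fun m => gd_P (D m) (u m)))) (fun m => gd_P (D m) (u m)) UU.
- rewrite -precompactE; apply: Dcompact; exists M => m.
  by have [] := uM m.
- by apply: filterE => m; apply: subset_closure; exists m.
have weak_lim y : (forall mu : dual L,
    (fun m => mu (gd_P (D m) (u m)) : R) @ U --> (mu y : R)) -> y = l.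
  move=> Hy; apply/eqP; rewrite -subr_eq0 -normr_eq0.
  have [mu <- _] := norming_functional (y - l).
  rewrite linearB subr_eq0; apply/eqP.
  apply: (@cvg_unique _ _ ((fun m => mu (gd_P (D m) (u m)) : R) @ U)) => //=.
  exact: (cvg_comp _ _ Pl (@dual_continuous _ _ mu _)).
have [A1s _ _] := A1.
have [|ubar [sol Pw Gw]] := ultra_limit_solution UU ooU.
  move=> y /weak_lim -> ww.
  exact: (cvg_comp (fun m => gd_P (D m) (u m)) (fun v => ba v ww) Pl (A1s ww l)).
by exists ubar; split => //; rewrite (weak_lim _ Pw).
Qed.

Variables (L_separable : separable_space L) (bL_separable : separable_space bL).

(** The countably many functionals of [separable_total] on L and on bL, together
    with h, are made to converge along one subsequence. The quantity h records a
    possible strong convergence. *)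
Lemma ultra_weak_subsequence (U : set_system nat) y z (h : nat -> R) :
  UltraFilter U -> \oo `<=` U ->
  (forall mu : dual L, (fun m => mu (gd_P (D m) (u m)) : R) @ U --> (mu y : R)) ->
  (forall mu : dual bL, (fun m => mu (gd_G (D m) (u m)) : R) @ U --> (mu z : R)) ->
  h @ U --> (0 : R) ->
  exists2 sigma : nat -> nat, {homo sigma : m n / (m < n)%N} &
    [/\ weakly_cvg (fun m => gd_P (D (sigma m)) (u (sigma m))) y,
        weakly_cvg (fun m => gd_G (D (sigma m)) (u (sigma m))) z &
        (fun m => h (sigma m)) @ \oo --> (0 : R)].
Proof.
move=> UU ooU Py Gz h0; have [M _ uM] := GS_solutions_bounded.
have [xi xi0] := separable_total L_separable.
have [eta eta0] := separable_total bL_separable.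
pose g (j : option (nat + nat)) m : R := match j with
  | Some (inl n) => xi n (gd_P (D m) (u m))
  | Some (inr n) => eta n (gd_G (D m) (u m))
  | None => h m end.
pose l (j : option (nat + nat)) : R := match j with
  | Some (inl n) => xi n y | Some (inr n) => eta n z | None => 0 end.
have [|sigma sh sl] := @ultra_countable_subsequence R _ U g l UU ooU.
  by case=> [[n|n]|] //=; [exact: Py|exact: Gz].
exists sigma => //; split; last exact: (sl None).
- apply: weakly_cvgP; apply: (weakly_cvg_of_total (M := M) L_reflexive xi0) => [m|n].
    by have [] := uM (sigma m).
  exact: (sl (Some (inl n))).
- apply: weakly_cvgP; apply: (weakly_cvg_of_total (M := M) bL_reflexive eta0) => [m|n].
    by have [] := uM (sigma m).
  exact: (sl (Some (inr n))).
Qed.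

End Convergence.

Theorem theorem4p10 (R : realType) (p p' : R) (hp : 1 < p)
  (hp' : p^-1 + p'^-1 = 1)
  (L bL : completeNormedModType R)
  (L_separable : separable_space L) (L_reflexive : reflexive_space L)
  (bL_separable : separable_space bL) (bL_reflexive : reflexive_space bL)
  (WG : submodClosed L) (WG_dense : dense [set x : L | x \in WG])
  (G : {linear submod_of WG -> bL}) (G_closed : closed_graph G)
  (V : submodClosed (dual L)) (V_closed : closed [set mu : dual L | mu \in V])
  (C : R) (C_gt0 : 0 < C)
  (norm_equiv : forall u : submod_of WG, normWG_graph p G u <= C * normWG p G V u)
  (alphaU alphaL : R) (alphaU_ge0 : 0 <= alphaU) (alphaL_gt0 : 0 < alphaL)
  (ba : L -> bL -> dual bL) (a : L -> dual L) (a_V : forall v : L, a v \in V)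
  (A1 : assumption_A1 p ba alphaU) (A2 : assumption_A2 ba)
  (A3 : assumption_A3 p ba alphaL) (A4 : assumption_A4 p a alphaU)
  (A5 : assumption_A5 a) (A6 : assumption_A6 p V a alphaL)
  (f : dual L) (bF : dual bL)
  (D : nat -> grad_disc p bL V)
  (D_consistent : consistent G D) (D_limit_conforming : limit_conforming G D) :
  (forall m : nat, exists u : gd_space (D m), GS_solution ba a f bF u)
  /\
  forall u : (forall m : nat, gd_space (D m)),
    (forall m : nat, GS_solution ba a f bF (u m)) ->
    [/\ depends_only_on_snd ba ->
          exists2 ubar : submod_of WG, P_solution G ba a f bF ubar &
          exists2 sigma : nat -> nat, {homo sigma : m n / (m < n)%N} &
            weakly_cvg (fun m => gd_P (D (sigma m)) (u (sigma m))) (val ubar) /\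
            weakly_cvg (fun m => gd_G (D (sigma m)) (u (sigma m))) (G ubar),
        compact_gds D ->
          exists2 ubar : submod_of WG, P_solution G ba a f bF ubar &
          exists2 sigma : nat -> nat, {homo sigma : m n / (m < n)%N} &
            (fun m => gd_P (D (sigma m)) (u (sigma m))) @ \oo --> val ubar /\
            weakly_cvg (fun m => gd_G (D (sigma m)) (u (sigma m))) (G ubar),
        depends_only_on_snd ba ->
          forall ubar : submod_of WG, unique (P_solution G ba a f bF) ubar ->
            weakly_cvg (fun m => gd_P (D m) (u m)) (val ubar) /\
            weakly_cvg (fun m => gd_G (D m) (u m)) (G ubar) &
        compact_gds D ->
          forall ubar : submod_of WG, unique (P_solution G ba a f bF) ubar ->
            (fun m => gd_P (D m) (u m)) @ \oo --> val ubar /\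
            weakly_cvg (fun m => gd_G (D m) (u m)) (G ubar)].
Proof.
split=> [m|u u_sol]; first exact: (GS_solution_exists hp (D m) f bF alphaU_ge0 A3 A6).
have mono U (UU : UltraFilter U) (ooU : \oo `<=` U) := ultra_limit_monotone hp
  L_reflexive bL_reflexive WG_dense G_closed C_gt0 norm_equiv alphaU_ge0 alphaL_gt0
  A1 A2 A3 A4 A5 A6 D_consistent D_limit_conforming u_sol UU ooU.
have comp U (UU : UltraFilter U) (ooU : \oo `<=` U) := ultra_limit_compact hp
  L_reflexive bL_reflexive WG_dense G_closed C_gt0 norm_equiv alphaU_ge0 alphaL_gt0
  A1 A2 A3 A4 A5 A6 D_consistent D_limit_conforming u_sol UU ooU.
have subseq := ultra_weak_subsequence hp L_reflexive bL_reflexive WG_dense C_gt0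
  norm_equiv alphaL_gt0 A3 A6 D_limit_conforming u_sol L_separable bL_separable.
(* The last two claims quantify over all ultrafilters; the first two need one. *)
have [U [UU ooU]] := ultraFilterLemma eventually_filter.
split.
- move=> /(mono U UU ooU)[ubar [sol Pw Gw]]; exists ubar => //.
  have [sigma sh [Ps Gs _]] := subseq U _ _ _ UU ooU Pw Gw (cvg_cst 0).
  by exists sigma.
- move=> /(comp U UU ooU)[ubar [sol Ps Gw]]; exists ubar => //.
  have Pw (mu : dual L) :
      (fun m => mu (gd_P (D m) (u m)) : R) @ U --> (mu (val ubar) : R).
    exact: (cvg_comp _ _ Ps (@dual_continuous _ _ mu _)).
  have h0 : (fun m => `|gd_P (D m) (u m) - val ubar|) @ U --> (0 : R).
    by apply/norm_cvg0P/subr_cvg0.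
  have [sigma sh [_ Gs hs]] := subseq U _ _ _ UU ooU Pw Gw h0.
  by exists sigma => //; split => //; apply/subr_cvg0/norm_cvg0P.
- move=> ba2 ubar [_ uniq]; split; apply: weakly_cvgP => mu;
    apply: cvg_ultraP => W WU ooW;
    by have [v [/uniq -> Pw Gw]] := mono W WU ooW ba2.
- move=> cD ubar [_ uniq]; split; last apply: weakly_cvgP => mu;
    apply: cvg_ultraP => W WU ooW;
    by have [v [/uniq -> Ps Gw]] := comp W WU ooW cD.
Qed.
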